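(* Let $G$ be a discrete group. Let $\varphi\colon G\to\mathbb{C}$ be a positive definite function with $\varphi(e)=1$. An element $\sum_s x_s\lambda_s$ of the group von Neumann algebra $\mathrm{VN}(G)$ belongs to the multiplicative domain $\mathrm{MD}(M_\varphi)$ of the Fourier multiplier $M_\varphi\colon\mathrm{VN}(G)\to\mathrm{VN}(G)$ if and only if for any $s\in G$ the condition $x_s\neq0$ implies $|\varphi(s)|=1$. That is, $$\mathrm{MD}(M_\varphi)=\mathrm{VN}(G_\varphi).$$
   Context: $\mathrm{VN}(G)$ is the von Neumann algebra generated by the left translations $\lambda_s$, $s\in G$, on $\ell^2_G$, with canonical trace $\tau$, $\tau(\lambda_s)=\delta_{s,e}$; the notation $\sum_s x_s\lambda_s$ denotes the element with Fourier coefficients $x_s=\tau(x\lambda_s^* )$. $M_\varphi$ is the weak* continuous map with $M_\varphi(\lambda_s)=\varphi(s)\lambda_s$. $G_\varphi=\{s\in G:|\varphi(s)|=1\}$, which is a subgroup of $G$, and $\mathrm{VN}(G_\varphi)$ is identified with the von Neumann subalgebra of $\mathrm{VN}(G)$ generated by $\lambda_s$, $s\in G_\varphi$. The multiplicative domain of a map $T\colon A\to B$ is $\mathrm{MD}(T)=\{x\in A:T(xy)=T(x)T(y)\text{ and }T(yx)=T(y)T(x)\text{ for all }y\in A\}$. *)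

(* Defs.v *)
From HB Require Import structures.
From mathcomp Require Import all_boot all_order all_algebra finmap.
From mathcomp Require Import all_classical all_reals all_analysis.
From mathcomp Require Import complex.
From mathcomp Require summability.
From mathcomp Require Import ring lra.

Set Implicit Arguments.
Unset Strict Implicit.
Unset Printing Implicit Defensive.

Import Order.TTheory GRing.Theory Num.Theory.
Import numFieldNormedType.Exports.

Local Open Scope classical_set_scope.
Local Open Scope ring_scope.

(* The topology of R[i] is only available through its numFieldType
   structure, hence the explicit packaging. *)
Definition Cplx (R : realType) : numClosedFieldType := R[i].

Definition modulus (R : realType) (z : Cplx R) : R := ComplexField.Normc.normc z.

Section EsumScale.
Variables (R : realType) (T : choiceType).
Implicit Types (a b : T -> R).

Lemma esumZ_le (r : R) a : 0 <= r -> (forall s, 0 <= a s) ->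
  (\esum_(s in [set: T]) (r * a s)%:E <=
   r%:E * \esum_(s in [set: T]) (a s)%:E)%E.
Proof.
move=> r0 a0; apply: ge_ereal_sup => _ [X [finX _] <-].
under eq_fsbigr do rewrite EFinM.
rewrite -ge0_mule_fsumr; last by move=> s; rewrite lee_fin.
apply: lee_wpmul2l; first by rewrite lee_fin.
by apply: ereal_sup_ubound; exists X.
Qed.

Lemma esum_fin_fine a : (forall s, 0 <= a s) ->
  (\esum_(s in [set: T]) (a s)%:E < +oo)%E ->
  \esum_(s in [set: T]) (a s)%:E =
  (fine (\esum_(s in [set: T]) (a s)%:E))%:E.
Proof.
move=> a0 afin; rewrite fineK// ge0_fin_numE// esum_ge0// => s _.
by rewrite lee_fin.
Qed.

Lemma fine_esum_ge0 a : (forall s, 0 <= a s) ->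
  0 <= fine (\esum_(s in [set: T]) (a s)%:E).
Proof.
by move=> a0; apply: fine_ge0; apply: esum_ge0 => s _; rewrite lee_fin.
Qed.

End EsumScale.

Section Modulus.
Variable R : realType.
Implicit Types z w : Cplx R.

Lemma modulusE z : `|z| = (modulus z)%:C%C :> R[i].
Proof. by []. Qed.

Lemma modulus_ge0 z : 0 <= modulus z.
Proof. by rewrite /modulus; case: z => a b /=; exact: sqrtr_ge0. Qed.

Lemma modulusM z w : modulus (z * w) = modulus z * modulus w.
Proof. exact: ComplexField.Normc.normcM. Qed.

Lemma modulusD z w : modulus (z + w) <= modulus z + modulus w.
Proof.
by have := ler_normD (z : R[i]) w; rewrite !modulusE -rmorphD/= lecR.
Qed.

Lemma modulus0 : modulus (0 : Cplx R) = 0.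
Proof. by rewrite /modulus/= expr0n/= addr0 sqrtr0. Qed.

Lemma modulus_eq0 z : modulus z = 0 -> z = 0.
Proof. exact: ComplexField.Normc.eq0_normc. Qed.

End Modulus.

Section Ell2.
Variables (R : realType) (G : choiceType).
Local Notation C := (Cplx R).
Implicit Types f g : G -> C.

Definition sqsum f : \bar R := \esum_(s in [set: G]) (modulus (f s) ^+ 2)%:E.

Definition square_summable : {pred (G -> C)} := fun f => `[< (sqsum f < +oo)%E >].

Lemma sqsum_ge0 f : (0 <= sqsum f)%E.
Proof. by apply: esum_ge0 => s _; rewrite lee_fin sqr_ge0. Qed.

Lemma sqsumZ_le (c : C) f :
  (sqsum (c *: f)%R <= (modulus c ^+ 2)%:E * sqsum f)%E.
Proof.
rewrite /sqsum; under eq_esum => s _ do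
  rewrite [(c *: f) s](_ : _ = c * f s)// modulusM exprMn.
by apply: esumZ_le => [|s]; exact: sqr_ge0.
Qed.

(* Weighted form of the inequality |x + y|^2 <= (|x| + |y|)^2. *)
Lemma sqsumD_le (t : R) f g : 0 < t ->
  (sqsum (f + g)%R <= (1 + t)%:E * sqsum f + (1 + t^-1)%:E * sqsum g)%E.
Proof.
move=> t0; have ti0 : 0 < t^-1 by rewrite invr_gt0.
have := @esumZ_le R G (1 + t) (fun s => modulus (f s) ^+ 2).
move=> /(_ (addr_ge0 ler01 (ltW t0)) (fun s => sqr_ge0 _)) hf.
have := @esumZ_le R G (1 + t^-1) (fun s => modulus (g s) ^+ 2).
move=> /(_ (addr_ge0 ler01 (ltW ti0)) (fun s => sqr_ge0 _)) hg.
apply: le_trans (leeD hf hg); rewrite -esumD; last 2 first.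
- by move=> s _; rewrite lee_fin mulr_ge0 ?sqr_ge0// addr_ge0// ltW.
- by move=> s _; rewrite lee_fin mulr_ge0 ?sqr_ge0// addr_ge0// ltW.
apply: le_esum => s _; rewrite -EFinD lee_fin [(f + g) s](_ : _ = f s + g s)//.
set x := modulus (f s); set y := modulus (g s).
apply: (@le_trans _ _ ((x + y) ^+ 2)).
  by rewrite lerXn2r ?nnegrE ?addr_ge0 ?modulus_ge0 ?modulusD.
rewrite -subr_ge0 [X in 0 <= X](_ : _ = t^-1 * (t * x - y) ^+ 2); last first.
  by field; rewrite gt_eqF.
by rewrite mulr_ge0 ?sqr_ge0// ltW.
Qed.

Lemma square_summable_submod : submod_closed square_summable.
Proof.
split=> [|c f g /asboolP fS /asboolP gS]; apply/asboolP.
  rewrite /sqsum esum1 ?ltry// => s _.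
  by rewrite [(0 : G -> C) s](_ : _ = 0)// modulus0 expr0n.
apply: le_lt_trans (sqsumD_le _ _ (ltr01)) _.
have cfS : (sqsum (c *: f)%R < +oo)%E.
  apply: le_lt_trans (sqsumZ_le _ _) _; rewrite lte_mul_pinfty// ?lee_fin.
  exact: sqr_ge0.
by rewrite lte_add_pinfty// lte_mul_pinfty// lee_fin addr_ge0// ltW// ?invr1.
Qed.

HB.instance Definition _ :=
  GRing.isSubmodClosed.Build C (G -> C) square_summable square_summable_submod.

Record ell2 := Ell2 { ell2_fun :> G -> C ; _ : ell2_fun \in square_summable }.

HB.instance Definition _ := [isSub for ell2_fun].
HB.instance Definition _ := [Choice of ell2 by <:].
HB.instance Definition _ := [SubChoice_isSubLmodule of ell2 by <:].


Implicit Types (u v : ell2) (c : C).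

Definition sqnorm u : R := fine (sqsum u).

Definition ell2_norm u : C := (Num.sqrt (sqnorm u))%:C%C.

Let sqsum_fine u : sqsum u = (sqnorm u)%:E.
Proof.
by apply: esum_fin_fine => [s|]; [exact: sqr_ge0|case: u => f /= /asboolP].
Qed.

Let sqsum_fine_ge0 u : 0 <= sqnorm u.
Proof. by apply: fine_esum_ge0 => s; exact: sqr_ge0. Qed.

Let sqsum_eq0 u : sqnorm u = 0 -> u = 0.
Proof.
move=> u0; apply/val_inj/funext => s /=.
rewrite [RHS](_ : _ = 0 :> C)//; apply: modulus_eq0; apply/eqP.
rewrite -sqrf_eq0 eq_le sqr_ge0 andbT -lee_fin.
rewrite [leRHS](_ : _ = sqsum u) ?[RHS]sqsum_fine ?u0//.
apply: esum_ge; exists [set s]; first by split=> //; exact: finite_set1.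
by rewrite fsbig_set1.
Qed.

Let sqsumZ c u : sqnorm (c *: u) = modulus c ^+ 2 * sqnorm u.
Proof.
have le c' w : sqnorm (c' *: w) <= modulus c' ^+ 2 * sqnorm w.
  by have := sqsumZ_le c' w; rewrite (sqsum_fine w) (sqsum_fine (c' *: w)).
have [->|c0] := eqVneq c 0.
  apply/eqP; rewrite eq_le le modulus0 expr0n mul0r.
  exact: sqsum_fine_ge0.
apply/eqP; rewrite eq_le le/=.
have m0 : 0 < modulus c ^+ 2.
  rewrite exprn_gt0// lt_def modulus_ge0 andbT.
  by apply: contra_neq c0; exact: modulus_eq0.
have mV : modulus c ^+ 2 * modulus c^-1 ^+ 2 = 1.
  rewrite -exprMn -modulusM mulfV// /modulus/= expr0n/= addr0.
  by rewrite expr1n sqrtr1 expr1n.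
have := le c^-1 (c *: u); rewrite scalerA mulVf// scale1r.
by rewrite -(ler_pM2l m0) mulrA mV mul1r.
Qed.

Lemma ell2_normD u v : ell2_norm (u + v) <= ell2_norm u + ell2_norm v.
Proof.
rewrite /ell2_norm -rmorphD/= lecR.
set a := Num.sqrt (sqnorm u); set b := Num.sqrt (sqnorm v).
have [a0 b0] : 0 <= a /\ 0 <= b by split; exact: sqrtr_ge0.
have aE : sqnorm u = a ^+ 2 by rewrite sqr_sqrtr.
have bE : sqnorm v = b ^+ 2 by rewrite sqr_sqrtr.
have [a00|an0] := eqVneq a 0.
  have -> : u = 0 by apply: sqsum_eq0; rewrite aE a00 expr0n.
  by rewrite add0r lerDr.
have [b00|bn0] := eqVneq b 0.
  have -> : v = 0 by apply: sqsum_eq0; rewrite bE b00 expr0n.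
  by rewrite addr0 lerDl.
have [ap bp] : 0 < a /\ 0 < b by rewrite !lt_def an0 bn0.
rewrite -(ler_pXn2r (ltn0Sn 1)) ?nnegrE ?addr_ge0 ?sqrtr_ge0//.
rewrite sqr_sqrtr//.
have := sqsumD_le u v (divr_gt0 bp ap).
rewrite (sqsum_fine u) (sqsum_fine v).
rewrite [X in (X <= _)%E -> _](sqsum_fine (u + v)) -!EFinM -EFinD lee_fin aE bE.
move=> /le_trans; apply; rewrite le_eqVlt; apply/orP; left; apply/eqP.
by field; rewrite an0 bn0.
Qed.

Lemma ell2_normZ c u : ell2_norm (c *: u) = `|c| * ell2_norm u.
Proof.
rewrite /ell2_norm sqsumZ modulusE -rmorphM/= sqrtrM ?sqr_ge0//.
by rewrite sqrtr_sqr ger0_norm// modulus_ge0.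
Qed.

Lemma ell2_norm0_eq0 u : ell2_norm u = 0 -> u = 0.
Proof.
move=> /(congr1 (@complex.Re R))/= /eqP; rewrite sqrtr_eq0 => u0.
by apply: sqsum_eq0; apply/eqP; rewrite eq_le u0 sqsum_fine_ge0.
Qed.

HB.instance Definition _ :=
  Lmodule_isNormed.Build C ell2 ell2_normD ell2_normZ ell2_norm0_eq0.

Definition inner u v : C := summability.sum (fun s => u s * (v s)^*).

Lemma delta_subproof (t : G) :
  (fun s : G => (s == t)%:R : C) \in square_summable.
Proof.
apply/asboolP; rewrite /sqsum.
rewrite [X in (X < _)%E](_ : _ = 1%E) ?ltry//.
rewrite (esumID [set t]) => [|s _]; last by rewrite lee_fin sqr_ge0.
rewrite setTI esum_set1; last by rewrite lee_fin sqr_ge0.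
rewrite eqxx esum1 ?adde0 => [|s [_ /eqP/negPf ->]].
  by rewrite /modulus/= expr0n/= addr0 expr1n sqrtr1 expr1n.
by rewrite modulus0 expr0n.
Qed.

Definition delta (t : G) : ell2 := Ell2 (delta_subproof t).

End Ell2.

Lemma isometry_continuous (K : numFieldType) (V W : normedModType K)
  (f : V -> W) : linear f -> (forall u, `|f u| = `|u|) -> continuous f.
Proof.
move=> flin fnorm u; apply/cvgrPdist_le => /= e e0; near=> v.
have -> : f u - f v = f (u - v).
  by have := flin (-1) v u; rewrite !scaleN1r => h; rewrite addrC -h addrC.
by rewrite fnorm; near: v; exact: cvgr_dist_le.
Unshelve. all: by end_near. Qed.

Section BoundedOperators.
Variables (R : realType) (G : groupType).
Local Notation C := (Cplx R).
Local Notation H := (ell2 R G).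

Definition bounded_operator : {pred (H -> H)} :=
  fun T => `[< linear T /\ continuous T >].

Lemma bounded_operator_submod : submod_closed bounded_operator.
Proof.
split=> [|c S T /asboolP[Sl Sc] /asboolP[Tl Tc]]; apply/asboolP; split.
- by move=> a u v; change (0 = a *: 0 + 0 :> H); rewrite scaler0 addr0.
- exact: (@cst_continuous _ _ (0 : H)).
- move=> a u v; change (c *: S (a *: u + v) + T (a *: u + v) =
    a *: (c *: S u + T u) + (c *: S v + T v)).
  by rewrite Sl Tl !scalerDr !scalerA [c * a]mulrC addrACA.
- by move=> u; exact: (cvgD (cvgZl_tmp (k:=c) (Sc u)) (Tc u)).
Qed.

HB.instance Definition _ := GRing.isSubmodClosed.Build C (H -> H)
  bounded_operator bounded_operator_submod.

Record bop := Bop { bop_fun :> H -> H ; _ : bop_fun \in bounded_operator }.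

HB.instance Definition _ := [isSub for bop_fun].
HB.instance Definition _ := [Choice of bop by <:].
HB.instance Definition _ := [SubChoice_isSubLmodule of bop by <:].

Lemma bop_linear (T : bop) : linear T.
Proof. by case: T => T /= /asboolP[]. Qed.

Lemma bop_continuous (T : bop) : continuous T.
Proof. by case: T => T /= /asboolP[]. Qed.

Lemma bop_comp_subproof (S T : bop) : S \o T \in bounded_operator.
Proof.
apply/asboolP; split=> [a u v /=|u]; first by rewrite !bop_linear.
by apply: continuous_comp; exact: bop_continuous.
Qed.

Lemma bop_id_subproof : (id : H -> H) \in bounded_operator.
Proof. by apply/asboolP; split=> // u; exact: cvg_id. Qed.

Definition bop_comp S T : bop := Bop (bop_comp_subproof S T).
Definition bop_id : bop := Bop bop_id_subproof.

Let bop_compA : associative bop_comp.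
Proof. by move=> S T U; exact: val_inj. Qed.

Let bop_comp1l : left_id bop_id bop_comp.
Proof. by move=> T; exact: val_inj. Qed.

Let bop_comp1r : right_id bop_id bop_comp.
Proof. by move=> T; exact: val_inj. Qed.

Let bop_compDl : left_distributive bop_comp +%R.
Proof. by move=> S T U; exact: val_inj. Qed.

Let bop_compDr : right_distributive bop_comp +%R.
Proof.
move=> S T U; apply/val_inj/funext => u /=.
by have := bop_linear S 1 (T u) (U u); rewrite !scale1r.
Qed.

Let bop_id_neq0 : bop_id != 0.
Proof.
apply/eqP => /(congr1 (fun T : bop => T (delta R 1%g) 1%g)) /=.
by rewrite eqxx => /eqP; rewrite oner_eq0.
Qed.

HB.instance Definition _ := GRing.Zmodule_isNzRing.Build bop
  bop_compA bop_comp1l bop_comp1r bop_compDl bop_compDr bop_id_neq0.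

Let bop_scaleAl (c : C) (S T : bop) : c *: (S * T) = (c *: S) * T.
Proof. exact: val_inj. Qed.

HB.instance Definition _ := GRing.Lmodule_isLalgebra.Build C bop bop_scaleAl.

Let bop_scaleAr (c : C) (S T : bop) : c *: (S * T) = S * (c *: T).
Proof.
apply/val_inj/funext => u /=; have := bop_linear S c (T u) 0.
have := bop_linear S 1 0 0; rewrite !scale1r addr0 => /esym/eqP.
by rewrite -subr_eq0 addrK => /eqP ->; rewrite !addr0 => ->.
Qed.

HB.instance Definition _ := GRing.Lalgebra_isAlgebra.Build C bop bop_scaleAr.

Lemma sqsum_translation (s : G) (u : G -> C) :
  sqsum (fun t => u (s^-1 * t)%g) = sqsum u.
Proof.
rewrite /sqsum.
rewrite [RHS](reindex_esum [set: G] [set: G] (fun t : G => (s^-1 * t)%g))//.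
split=> [//|t t' _ _ /mulgI //|t _]; exists (s * t)%g => //.
by rewrite mulgA mulVg mul1g.
Qed.

Lemma translation_subproof (s : G) (u : H) :
  (fun t => u (s^-1 * t)%g) \in @square_summable R G.
Proof.
by apply/asboolP; rewrite sqsum_translation; case: u => u /= /asboolP.
Qed.

Definition translation (s : G) (u : H) : H := Ell2 (translation_subproof s u).

Lemma translation_bounded (s : G) : translation s \in bounded_operator.
Proof.
have tlin : linear (translation s) by move=> a u v; exact: val_inj.
have tnorm u : `|translation s u| = `|u|.
  by rewrite /Num.norm/= /ell2_norm /sqnorm sqsum_translation.
by apply/asboolP; split=> //; exact: isometry_continuous.
Qed.

Definition lambda (s : G) : bop := Bop (translation_bounded s).

End BoundedOperators.

Section VonNeumann.
Variables (R : realType) (G : groupType).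
Local Notation C := (Cplx R).
Local Notation H := (ell2 R G).
Local Notation B := (bop R G).
Implicit Types (A S : set B) (x y : B).

Definition is_adjoint x y := forall u v : H, inner (x u) v = inner u (y v).

Definition commutant S : set B := [set x | forall y, S y -> x * y = y * x].

Definition von_neumann_algebra A :=
  (forall x y, A x -> is_adjoint x y -> A y) /\ commutant (commutant A) = A.

Definition vn_generated S : set B :=
  \bigcap_(A in [set A | von_neumann_algebra A /\ S `<=` A]) A.

(* The von Neumann algebra generated by the left translations by K; for a
   subgroup K it is the copy of VN(K) inside VN(G). *)
Definition vn_translations (K : set G) : set B :=
  vn_generated [set lambda R s | s in K].

Definition vn_pred : {pred B} := fun x => `[< vn_translations [set: G] x >].

Lemma commutant1 S : commutant S 1.
Proof. by move=> z _; rewrite mul1r mulr1. Qed.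

Lemma commutant_lin S c x y :
  commutant S x -> commutant S y -> commutant S (c *: x + y).
Proof.
by move=> xS yS z Sz; rewrite mulrDl mulrDr -scalerAl -scalerAr xS// yS.
Qed.

Lemma commutantM S x y : commutant S x -> commutant S y -> commutant S (x * y).
Proof. by move=> xS yS z Sz; rewrite -mulrA yS// mulrA xS// mulrA. Qed.

Lemma vn_pred_subalg : subalg_closed vn_pred.
Proof.
split=> [|c x y /asboolP xV /asboolP yV|x y /asboolP xV /asboolP yV];
  apply/asboolP => A /= AP; have [[_ AE] _] := AP; rewrite -AE.
- exact: commutant1.
- by apply: commutant_lin; rewrite AE; [exact: xV|exact: yV].
- by apply: commutantM; rewrite AE; [exact: xV|exact: yV].
Qed.

HB.instance Definition _ := GRing.isSubalgClosed.Build C B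
  vn_pred vn_pred_subalg.

Record group_vn := GroupVN { group_vn_op :> B ; _ : group_vn_op \in vn_pred }.

HB.instance Definition _ := [isSub for group_vn_op].
HB.instance Definition _ := [Choice of group_vn by <:].
HB.instance Definition _ := [SubChoice_isSubAlgebra of group_vn by <:].

Lemma vn_lambda_subproof (s : G) : lambda R s \in vn_pred.
Proof. by apply/asboolP => A [_]; apply; exists s. Qed.

Definition vn_lambda (s : G) : group_vn := GroupVN (vn_lambda_subproof s).

End VonNeumann.

Section Reindex.
Variables (I : choiceType) (K : numDomainType) (V : normedModType K).

Lemma sum_reindex (e e' : I -> I) (x : I -> V) :
  cancel e e' -> cancel e' e ->
  summability.sum (x \o e) = summability.sum x.
Proof.
move=> eK e'K; rewrite /summability.sum.
have psE (h h' : I -> I) (y : I -> V) A : cancel h h' ->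
    summability.partial_sum (y \o h) A =
    summability.partial_sum y [fset h i | i in A]%fset.
  move=> hK; rewrite /summability.partial_sum.
  rewrite -(big_seq_fsetE _ _ xpredT (y \o h)) -(big_seq_fsetE _ _ xpredT y).
  by rewrite big_imfset//= => i j _ _; exact: can_inj hK _ _.
have sub (h h' : I -> I) (y : I -> V) : cancel h h' -> cancel h' h ->
    summability.partial_sum y @ summability.totally `<=`
    summability.partial_sum (y \o h) @ summability.totally.
  move=> hK h'K P [A _ AP]; exists [fset h' i | i in A]%fset => // A' /= AA'.
  rewrite /preimage/= (psE _ _ _ _ hK); apply: AP => /=.
  apply/fsubsetP => i iA; rewrite -(h'K i) in_imfset//=.
  by apply: (fsubsetP AA'); rewrite in_imfset.
congr (lim _); apply/seteqP; split; last exact: sub eK e'K.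
have /= := sub e' e (x \o e) e'K eK.
by rewrite (_ : (x \o e) \o e' = x)//; apply/funext => i /=; rewrite e'K.
Qed.

End Reindex.

Section FourierMultiplier.
Variables (R : realType) (G : groupType).
Local Notation C := (Cplx R).
Local Notation H := (ell2 R G).
Local Notation VN := (group_vn R G).

Lemma lambda_adjoint (s : G) : is_adjoint (lambda R s) (lambda R s^-1%g).
Proof.
move=> u v; rewrite /inner.
rewrite -(@sum_reindex _ _ _ (fun t => s * t)%g (fun t => s^-1 * t)%g) /=.
- by apply/congr1/funext => t /=; rewrite mulKg invgK.
- by move=> t; rewrite mulKg.
- by move=> t; rewrite mulVKg.
Qed.

Definition trace (x : VN) : C := inner (x (delta R 1%g)) (delta R 1%g).

(* The adjoint of vn_lambda s is vn_lambda s^-1, see lambda_adjoint. *)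
Definition fourier_coef (x : VN) (s : G) : C := trace (x * vn_lambda R s^-1%g).

Definition ell2_sequence :=
  {f : nat -> H | cvgn (series (fun n => `|f n| ^+ 2))}.

Definition normal_functional (p : ell2_sequence * ell2_sequence) (x : VN) : C :=
  limn (series (fun n => inner (x (sval p.1 n)) (sval p.2 n))).

(* VN(G) with its weak-star topology, i.e. the relative sigma-weak topology of
   the bounded operators: the predual consists of the restrictions of the
   functionals x |-> \sum_n <x f_n, g_n>. *)
Definition weak_star :=
  sup_topology (fun p => Topological.on (initial_topology (normal_functional p))).

Definition positive_definite (phi : G -> C) :=
  forall (n : nat) (s : 'I_n -> G) (c : 'I_n -> C),
    0 <= \sum_(i < n) \sum_(j < n) (c i)^* * c j * phi ((s i)^-1 * s j)%g.

Definition fourier_multiplier (phi : G -> C) (M : {linear VN -> VN}) :=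
  continuous (M : weak_star -> weak_star) /\
  forall s, M (vn_lambda R s) = phi s *: vn_lambda R s.

Definition unimodular_set (phi : G -> C) : set G := [set s | `|phi s| = 1].

Definition vn_subalgebra (K : set G) : set VN :=
  [set x | vn_translations K (\val x)].

End FourierMultiplier.

Definition multiplicative_domain (A B : pzSemiRingType) (T : A -> B) : set A :=
  [set x | forall y, T (x * y) = T x * T y /\ T (y * x) = T y * T x].

(* Main.v *)
(* An element x of VN(G) is determined by its Fourier coefficients, i.e. by the
   vector x delta_1, and the coefficients of a product are given by convolution.
   Weak-star continuity of M_phi and weak-star density of the span of the
   lambda_s show that M_phi multiplies the coefficient x_s by phi(s). If x is in
   MD(M_phi), comparing the coefficients at 1 of M_phi(x lambda_s^-1) and
   M_phi(x) M_phi(lambda_s^-1) gives x_s = |phi(s)|^2 x_s. Conversely, positive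
   definiteness on three points yields phi(st) = phi(s) phi(t) as soon as one of
   |phi(s)|, |phi(t)| is 1, so that the coefficients of M_phi(xy) and
   M_phi(x) M_phi(y) agree when x is supported in G_phi.

   Density is von Neumann's argument: an operator x commuting with the right
   translations commutes with every bounded Z commuting with the lambda_s (both
   composites have the same matrix), and so do its amplifications; applied to
   the projection onto the closure of {y f : y in the span}, this puts x f in
   that closure. The same matrix computation shows that x belongs to
   VN(G_phi) when it is supported in G_phi; the converse holds because the
   commutant of the right translations and of the projection onto l^2(G_phi)
   is a von Neumann algebra containing lambda_s for s in G_phi. *)

From HB Require Import structures.
Require Import Defs.
From mathcomp Require Import all_boot all_order all_algebra.
From mathcomp Require Import all_classical all_reals all_analysis.
From mathcomp Require Import finmap complex.
From mathcomp Require Import summability.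
From mathcomp Require Import ring lra.

Set Implicit Arguments.
Unset Strict Implicit.
Unset Printing Implicit Defensive.

Import Order.TTheory GRing.Theory Num.Theory.
Import numFieldNormedType.Exports.
Local Open Scope classical_set_scope.
Local Open Scope ring_scope.

#[local] Existing Instance totally_filter.

(** * Square-summable families *)

Section ComplexLimits.
Variable R : realType.
Local Notation C := (Cplx R).

(** Positive elements of [R[i]] are real, so the tolerance in a limit over [C] may always be taken
    in [R]. *)
Lemma Cplx_gt0 (e : C) : 0 < e -> exists2 r : R, 0 < r & e = r%:C%C.
Proof.
move=> e0; have /complex_realP[r er] : (e : R[i]) \is Num.real.
  exact: gtr0_real.
by exists r => //; move: e0; rewrite er (ltcR 0 r).
Qed.

Lemma cvg_realC (T : Type) (F : set_system T) {FF : Filter F} (f : T -> R)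
    (l : R) :
  f @ F --> l -> (fun x => (f x)%:C%C : C) @ F --> (l%:C%C : C).
Proof.
move=> /cvgrPdist_le fl; apply/cvgrPdist_le => e /Cplx_gt0[r r0 ->].
apply: filterS (fl _ r0) => x fx.
by rewrite -rmorphB normc_def/= expr0n/= addr0 sqrtr_sqr lecR.
Qed.

Lemma modulus_sqrE (z : C) : (modulus z ^+ 2)%:C%C = z * z^* :> C.
Proof. by rewrite -normCK modulusE rmorphXn. Qed.

Lemma modulus_sqr (z : C) :
  modulus z ^+ 2 = complex.Re z ^+ 2 + complex.Im z ^+ 2.
Proof. by apply: complexI; rewrite rmorphXn/= -modulusE add_Re2_Im2. Qed.

Lemma modulusN (z : C) : modulus (- z) = modulus z.
Proof. by apply: complexI; rewrite -!modulusE normrN. Qed.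

End ComplexLimits.

Lemma partial_sum_seq (I : choiceType) (V : zmodType) (x : I -> V)
    (A : {fset I}) :
  partial_sum x A = \sum_(i <- A) x i.
Proof. by rewrite /partial_sum -(big_seq_fsetE _ _ xpredT x). Qed.

(** Links the two kinds of sums in use: [sqsum] is a supremum over finite sets, [inner] a limit
    along the net of finite sets. *)
Lemma cvg_partial_sum_esum (R : realType) (I : choiceType) (a : I -> R) :
  (forall i, 0 <= a i) -> (\esum_(i in [set: I]) (a i)%:E < +oo)%E ->
  partial_sum a @ totally --> fine (\esum_(i in [set: I]) (a i)%:E).
Proof.
move=> a0 afin; set S := fine _.
have SE : \esum_(i in [set: I]) (a i)%:E = S%:E by exact: esum_fin_fine.
have leS (A : {fset I}) : partial_sum a A <= S.
  rewrite partial_sum_seq -lee_fin -SE; apply: ereal_sup_ubound.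
  exists [set` A]; first by split=> //; exact: finite_fset.
  by rewrite fsbig_finite//= set_fsetK sumEFin.
apply/cvgrPdist_le => e e0.
(* By definition of the supremum some finite set already has sum above [S - e]; enlarging it only
   adds nonnegative terms. *)
have : (S%:E - e%:E < \esum_(i in [set: I]) (a i)%:E)%E.
  by rewrite SE -EFinB lte_fin ltrBlDr ltrDl.
rewrite /esum => /ereal_sup_gt[_ [X [finX _] <-]].
rewrite fsbig_finite//= sumEFin -EFinB lte_fin => SX.
exists (fset_set X) => // A /= XA; rewrite ger0_norm ?subr_ge0// lerBlDr -lerBlDl.
apply: (le_trans (ltW SX)).
rewrite partial_sum_seq [leRHS](big_fsetID _ (mem (fset_set X)))/=.
rewrite [X in _ <= \sum_(i <- X) _ + _](_ : _ = enum_fset (fset_set X)); last first.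
  congr enum_fset.
  apply/fsetP => i; rewrite !inE/=; apply/andP/idP => [[]//|iX].
  by split=> //; exact: (fsubsetP XA).
by rewrite lerDl sumr_ge0.
Qed.

Section Ell2Inner.
Variables (R : realType) (I : choiceType).
Local Notation C := (Cplx R).
Local Notation H := (ell2 R I).
Implicit Types (u v w : H) (c : C).

Lemma sqsumE u : sqsum u = (sqnorm u)%:E.
Proof.
by apply: esum_fin_fine => [s|]; [exact: sqr_ge0|case: u => f /= /asboolP].
Qed.

Lemma sqnorm_ge0 u : 0 <= sqnorm u.
Proof. by apply: fine_esum_ge0 => s; exact: sqr_ge0. Qed.

Lemma cvg_sqnorm u :
  partial_sum (fun i => u i * (u i)^*) @ totally --> ((sqnorm u)%:C%C : C).
Proof.
have -> : partial_sum (fun i => u i * (u i)^*) =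
    fun A => (partial_sum (fun i => modulus (u i) ^+ 2) A)%:C%C :> C.
  apply/funext => A; rewrite !partial_sum_seq rmorph_sum/=.
  by apply: eq_bigr => i _; rewrite modulus_sqrE.
apply: cvg_realC; apply: cvg_partial_sum_esum => [i|]; first exact: sqr_ge0.
by have := sqsumE u; rewrite /sqsum => ->; rewrite ltry.
Qed.

Lemma ell2DE u v i : (u + v) i = u i + v i. Proof. by []. Qed.
Lemma ell2NE u i : (- u) i = - u i. Proof. by []. Qed.
Lemma ell2ZE c u i : (c *: u) i = c * u i. Proof. by []. Qed.

(** Polarization serves twice: it reduces the convergence of [inner] to that of squared norms, and
    it shows that a linear isometry preserves [inner]. *)
Definition polarization u v : C :=
  ((sqnorm (u + v))%:C%C - (sqnorm (u - v))%:C%C +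
   'i * (sqnorm (u + 'i *: v))%:C%C - 'i * (sqnorm (u - 'i *: v))%:C%C) / 4%:R.

Lemma cvg_polarization u v :
  partial_sum (fun i => u i * (v i)^*) @ totally --> polarization u v.
Proof.
have -> : partial_sum (fun i => u i * (v i)^*) =
  fun A => (partial_sum (fun i => (u + v) i * ((u + v) i)^*) A -
   partial_sum (fun i => (u - v) i * ((u - v) i)^*) A +
   'i * partial_sum (fun i => (u + 'i *: v) i * ((u + 'i *: v) i)^*) A -
   'i * partial_sum (fun i => (u - 'i *: v) i * ((u - 'i *: v) i)^*) A) / 4%:R.
  apply/funext => A; rewrite !partial_sum_seq !mulr_sumr -!sumrB -big_split.
  rewrite -sumrB mulr_suml; apply: eq_bigr => i _.
  rewrite !(ell2DE, ell2NE, ell2ZE).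
  rewrite !(rmorphD, rmorphN, rmorphM)/= conjCi.
  move: ((u i)^*) ((v i)^*) => a b.
  have i2 : 'i * 'i = -1 :> C by rewrite -expr2 sqrCi.
  apply: (mulIf (_ : 4%:R != 0 :> C)); first by rewrite pnatr_eq0.
  rewrite divfK ?pnatr_eq0//.
  transitivity (u i * b * 2%:R - (u i * b) * ('i * 'i) * 2%:R +
    v i * a * 2%:R + v i * a * ('i * 'i) * 2%:R); last ring.
  rewrite i2; ring.
apply: cvgMr_tmp; apply: cvgB; first apply: cvgD; first apply: cvgB.
- exact: cvg_sqnorm.
- exact: cvg_sqnorm.
- by apply: cvgMl_tmp; exact: cvg_sqnorm.
- by apply: cvgMl_tmp; exact: cvg_sqnorm.
Qed.

Lemma innerE u v : inner u v = polarization u v.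
Proof. by apply: cvg_lim => //; exact: cvg_polarization. Qed.

Lemma cvg_inner u v :
  partial_sum (fun i => u i * (v i)^*) @ totally --> inner u v.
Proof. by rewrite innerE; exact: cvg_polarization. Qed.

Lemma sum_unique (x : I -> C) (l : C) :
  partial_sum x @ totally --> l -> summability.sum x = l.
Proof. exact: cvg_lim. Qed.

Lemma inner_linear v : linear ((fun u => inner u v) : H -> C^o).
Proof.
move=> c u w; apply: sum_unique.
have -> : partial_sum (fun i => (c *: u + w) i * (v i)^*) =
    fun A => c * partial_sum (fun i => u i * (v i)^*) A +
             partial_sum (fun i => w i * (v i)^*) A.
  apply/funext => A; rewrite !partial_sum_seq mulr_sumr -big_split.
  apply: eq_bigr => i _.
  by rewrite ell2DE ell2ZE mulrDl mulrA.
by apply: cvgD; [apply: cvgMl_tmp|]; exact: cvg_inner.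
Qed.

Lemma cvg_conj (T : Type) (F : set_system T) {FF : Filter F} (f : T -> C)
    (l : C) :
  f @ F --> l -> (fun x => (f x)^*) @ F --> l^*.
Proof.
move=> /cvgrPdist_le fl; apply/cvgrPdist_le => e e0.
apply: filterS (fl _ e0) => x.
by rewrite -rmorphB norm_conjC.
Qed.

Lemma innerC u v : inner u v = (inner v u)^*.
Proof.
apply: sum_unique.
have -> : partial_sum (fun i => u i * (v i)^*) =
    fun A => (partial_sum (fun i => v i * (u i)^*) A)^*.
  apply/funext => A; rewrite !partial_sum_seq rmorph_sum/=.
  by apply: eq_bigr => i _; rewrite rmorphM/= conjCK mulrC.
by apply: cvg_conj; exact: cvg_inner.
Qed.

Lemma innerDl u v w : inner (u + v) w = inner u w + inner v w.
Proof. by have := inner_linear w 1 u v; rewrite !scale1r. Qed.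
Lemma inner0l w : inner 0 w = 0.
Proof. by apply: (addrI (inner 0 w)); rewrite -innerDl !addr0. Qed.
Lemma innerZl c u w : inner (c *: u) w = c * inner u w.
Proof. by have := inner_linear w c u 0; rewrite inner0l !addr0. Qed.
Lemma innerBl u v w : inner (u - v) w = inner u w - inner v w.
Proof. by rewrite innerDl -scaleN1r innerZl mulN1r. Qed.
Lemma innerBr u v w : inner w (u - v) = inner w u - inner w v.
Proof. by rewrite innerC innerBl rmorphB/= -!innerC. Qed.
Lemma innerZr c u w : inner w (c *: u) = c^* * inner w u.
Proof. by rewrite innerC innerZl rmorphM/= -!innerC. Qed.

Lemma inner_sqnorm u : inner u u = (sqnorm u)%:C%C.
Proof. by apply: sum_unique; exact: cvg_sqnorm. Qed.

Lemma sqnorm0 : sqnorm (0 : H) = 0.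
Proof. by apply: complexI; rewrite -inner_sqnorm inner0l. Qed.

Lemma sqnorm_eq0 u : sqnorm u = 0 -> u = 0.
Proof. by move=> u0; apply: ell2_norm0_eq0; rewrite /ell2_norm u0 sqrtr0. Qed.

Lemma ell2_normE u : `|u| = (Num.sqrt (sqnorm u))%:C%C.
Proof. by []. Qed.

Lemma sqr_normE u : `|u| ^+ 2 = (sqnorm u)%:C%C.
Proof. by rewrite ell2_normE -rmorphXn/= sqr_sqrtr ?sqnorm_ge0. Qed.

Lemma sqnormB u v : (sqnorm (u - v))%:C%C =
  (sqnorm u)%:C%C + (sqnorm v)%:C%C - inner u v - (inner u v)^* :> C.
Proof. rewrite -!inner_sqnorm innerBl !innerBr -(innerC v u); ring. Qed.

Lemma sqnormZ c u : sqnorm (c *: u) = modulus c ^+ 2 * sqnorm u.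
Proof.
apply: complexI; rewrite -inner_sqnorm innerZl innerZr mulrA -modulus_sqrE.
by rewrite inner_sqnorm -rmorphM.
Qed.

Lemma sqnormN u : sqnorm (- u) = sqnorm u.
Proof.
rewrite -scaleN1r sqnormZ modulusN /modulus/= expr0n/= addr0.
by rewrite expr1n sqrtr1 expr1n mul1r.
Qed.

Lemma sqnorm_subC u v : sqnorm (u - v) = sqnorm (v - u).
Proof. by rewrite -sqnormN opprB. Qed.

Lemma inner_delta u i : inner u (delta R i) = u i.
Proof.
apply: sum_unique; apply: cvg_near_cst; exists [fset i]%fset => // A /= iA.
rewrite partial_sum_seq (big_fsetD1 i) ?(fsubsetP iA) ?inE//= eqxx conjC1 mulr1.
rewrite big_seq big1 ?addr0// => j; rewrite !inE => /andP[/negPf -> _].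
by rewrite conjC0 mulr0.
Qed.

Lemma ell2P u v : (forall i, u i = v i) -> u = v.
Proof. by move=> uv; apply/val_inj/funext. Qed.

Lemma Cauchy_Schwarz u v : modulus (inner u v) ^+ 2 <= sqnorm u * sqnorm v.
Proof.
have [v0|v0] := eqVneq (sqnorm v) 0.
  rewrite (sqnorm_eq0 v0) innerC inner0l conjC0 modulus0 expr0n/=.
  by rewrite mulr_ge0// sqnorm_ge0.
have vgt : 0 < sqnorm v by rewrite lt_def v0 sqnorm_ge0.
rewrite -(ler_pM2l vgt) -subr_ge0.
(* The squared norm of [|v|^2 u - <u, v> v] is [|v|^2 (|u|^2 |v|^2 - |<u, v>|^2)]; this multiple of
   the usual vector avoids any division. *)
have := sqnorm_ge0 ((sqnorm v)%:C%C *: u - inner u v *: v).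
congr (_ <= _); apply: complexI.
rewrite sqnormB !sqnormZ innerZl innerZr.
rewrite [modulus (sqnorm v)%:C%C](_ : _ = sqnorm v); last first.
  by rewrite /modulus/= expr0n/= addr0 sqrtr_sqr ger0_norm ?sqnorm_ge0.
have := modulus_sqrE (inner u v); set m := modulus _ ^+ 2 => mE; clearbody m.
have rC : ((sqnorm v)%:C%C : C)^* = (sqnorm v)%:C%C.
  by rewrite -inner_sqnorm -innerC.
rewrite !(rmorphM, rmorphB)/=.
rewrite conjCK rC mE.
set a := ((sqnorm v)%:C)%C; set b := ((sqnorm u)%:C)%C.
by move: (inner u v) ((inner u v)^*) => z z'; ring.
Qed.

Lemma sqnorm_coord_le u i : modulus (u i) ^+ 2 <= sqnorm u.
Proof.
have := Cauchy_Schwarz u (delta R i); rewrite inner_delta => /le_trans; apply.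
have -> : sqnorm (delta R i) = 1; last by rewrite mulr1.
by apply: complexI; rewrite -inner_sqnorm inner_delta/= eqxx.
Qed.

End Ell2Inner.

Section Convergence.
Variables (R : realType) (I : choiceType).
Local Notation C := (Cplx R).
Local Notation H := (ell2 R I).

Lemma cvg_ell2P (T : Type) (F : set_system T) {FF : Filter F} (f : T -> H)
    (l : H) :
  f @ F --> l <-> (fun x => sqnorm (f x - l)) @ F --> (0 : R).
Proof.
split=> [/cvgrPdist_le fl|/cvgrPdist_le fl]; apply/cvgrPdist_le.
  move=> e e0; have se0 : (0 : C) < (Num.sqrt e)%:C%C by rewrite (ltcR 0) sqrtr_gt0.
  apply: filterS (fl _ se0) => x; rewrite ell2_normE lecR ler_sqrt ?(ltW e0)//.
  by rewrite sub0r normrN ger0_norm ?sqnorm_ge0// sqnorm_subC.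
move=> _ /Cplx_gt0[r r0 ->]; apply: filterS (fl _ (exprn_gt0 2 r0)) => x.
rewrite sub0r normrN ger0_norm ?sqnorm_ge0// sqnorm_subC => h.
rewrite ell2_normE lecR -(ger0_norm (ltW r0)) -sqrtr_sqr.
by rewrite ler_sqrt// sqr_ge0.
Qed.

Lemma cvg_ell2_coord (T : Type) (F : set_system T) {FF : Filter F} (f : T -> H)
    (l : H) (i : I) :
  f @ F --> l -> (fun x => f x i) @ F --> l i.
Proof.
move=> /cvgrPdist_le fl; apply/cvgrPdist_le => e e0.
apply: filterS (fl _ e0) => x; apply: le_trans.
rewrite -ell2NE -ell2DE ell2_normE modulusE lecR.
rewrite -(ger0_norm (modulus_ge0 _)) -sqrtr_sqr ler_sqrt ?sqnorm_ge0//.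
exact: sqnorm_coord_le.
Qed.

Lemma deltaE (i j : I) : delta R i j = (j == i)%:R. Proof. by []. Qed.

Definition truncation (u : H) (A : {fset I}) : H :=
  \sum_(i <- A) u i *: delta R i.

Lemma ell2_sumE (J : Type) (r : seq J) (f : J -> H) (i : I) :
  (\sum_(j <- r) f j) i = \sum_(j <- r) f j i.
Proof. by elim/big_rec2: _ => // j a b _ <-. Qed.

Lemma truncationE (u : H) (A : {fset I}) i :
  truncation u A i = if i \in A then u i else 0.
Proof.
rewrite ell2_sumE; case: ifPn => iA.
  rewrite (big_fsetD1 i)// ell2ZE deltaE eqxx mulr1 big_seq big1.
    by rewrite /= addr0.
  move=> j; rewrite !inE eq_sym ell2ZE deltaE => /andP[/negPf -> _].
  by rewrite mulr0.
rewrite big_seq big1// => j jA; rewrite ell2ZE deltaE.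
rewrite [i == j](_ : _ = false) ?mulr0//.
by apply: contraNF iA => /eqP ->.
Qed.

(** Pythagoras: the truncation is orthogonal to the remainder, so its convergence to [u] is that of
    the sum of squares. *)
Lemma sqnorm_truncation (u : H) (A : {fset I}) :
  sqnorm (truncation u A - u) =
  sqnorm u - partial_sum (fun i => modulus (u i) ^+ 2) A.
Proof.
have tE (w : H) : inner (truncation u A) w = \sum_(i <- A) u i * (w i)^*.
  rewrite /truncation; elim: (enum_fset A) => [|i s IH].
    by rewrite !big_nil inner0l.
  by rewrite !big_cons innerDl IH innerZl innerC inner_delta.
apply: complexI; rewrite rmorphB sqnormB -(inner_sqnorm (truncation u A)) !tE.
rewrite [in LHS]big_seq (eq_bigr (fun i => u i * (u i)^*)); last first.
  by move=> i iA; rewrite truncationE iA.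
rewrite -big_seq partial_sum_seq.
have pE : (\sum_(i <- A) modulus (u i) ^+ 2)%:C%C =
    \sum_(i <- A) u i * (u i)^* :> C.
  by rewrite rmorph_sum/=; apply: eq_bigr => i _; rewrite modulus_sqrE.
have pC : (\sum_(i <- A) u i * (u i)^*)^* = \sum_(i <- A) u i * (u i)^*.
  by rewrite rmorph_sum; apply: eq_bigr => i _; rewrite rmorphM/= conjCK mulrC.
by rewrite pC [X in _ = _ - X]pE; ring.
Qed.

Lemma cvg_truncation (u : H) : truncation u @ totally --> u.
Proof.
apply/cvg_ell2P; under eq_fun do rewrite sqnorm_truncation.
have uS : partial_sum (fun i => modulus (u i) ^+ 2) @ totally --> sqnorm u.
  apply: cvg_partial_sum_esum => [i|]; first exact: sqr_ge0.
  by have := sqsumE u; rewrite /sqsum => ->; rewrite ltry.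
by have := cvgB (cvg_cst (sqnorm u)) uS; rewrite subrr; exact.
Qed.

End Convergence.

(** * Continuous linear maps and their matrices *)

Section LinearMaps.
Variables (R : realType) (I J : choiceType).
Local Notation C := (Cplx R).
Implicit Types T : ell2 R I -> ell2 R J.

Definition continuous_linear T := linear T /\ continuous T.

Lemma linear_fun0 T : linear T -> T 0 = 0.
Proof.
move=> Tl; have := Tl 1 0 0; rewrite !scale1r addr0 => /esym/eqP.
by rewrite -subr_eq0 addrK => /eqP.
Qed.

Lemma linear_funB T u v : linear T -> T (u - v) = T u - T v.
Proof. by move=> Tl; rewrite addrC -scaleN1r Tl scaleN1r addrC. Qed.

Lemma linear_funD T u v : linear T -> T (u + v) = T u + T v.
Proof. by move=> Tl; have := Tl 1 u v; rewrite !scale1r. Qed.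

Lemma linear_fun_sum T (K : Type) (r : seq K) (c : K -> C) (f : K -> ell2 R I) :
  linear T -> T (\sum_(k <- r) c k *: f k) = \sum_(k <- r) c k *: T (f k).
Proof.
move=> Tl; elim: r => [|k r IH]; first by rewrite !big_nil linear_fun0.
by rewrite !big_cons Tl IH.
Qed.

(** The matrix of [T] acts as expected because the truncations of [w] converge to [w], while [T] and
    the coordinates are continuous. Operators can then be compared entry by entry. *)
Lemma continuous_linear_sum T (w : ell2 R I) (j : J) : continuous_linear T ->
  T w j = summability.sum (fun i => w i * T (delta R i) j).
Proof.
move=> [Tl Tc]; apply/esym/sum_unique.
have -> : partial_sum (fun i => w i * T (delta R i) j) =
    fun A => T (truncation w A) j.
  apply/funext => A; rewrite /truncation linear_fun_sum// ell2_sumE partial_sum_seq.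
  by apply: eq_bigr => i _; rewrite ell2ZE.
by apply: cvg_ell2_coord; exact: (cvg_comp _ _ (@cvg_truncation R I w) (Tc w)).
Qed.

Lemma continuous_linear_bounded T : continuous_linear T ->
  exists2 k : R, 0 <= k & forall u, sqnorm (T u) <= k * sqnorm u.
Proof.
move=> [Tl Tc].
pose Tlin : {linear ell2 R I -> ell2 R J} :=
  HB.pack T (GRing.isLinear.Build C (ell2 R I) (ell2 R J) *:%R T Tl).
have /linear_bounded_continuous/linear_boundedP := (Tc : continuous Tlin).
move=> [k0 [k0r /(_ (`|k0| + 1))]].
have kgt : k0 < `|k0| + 1.
  by rewrite (le_lt_trans (real_ler_norm k0r))// ltrDl.
move=> /(_ kgt) Tb.
have /Cplx_gt0[k kp kE] : 0 < `|k0| + 1 by rewrite ltr_wpDl.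
exists (k ^+ 2) => [|u]; first exact: sqr_ge0.
have := Tb u; rewrite kE /= !ell2_normE -rmorphM/= lecR => h.
rewrite -(sqr_sqrtr (sqnorm_ge0 (T u))) -[sqnorm u]sqr_sqrtr ?sqnorm_ge0//.
rewrite -exprMn lerXn2r// nnegrE ?sqrtr_ge0// mulr_ge0// ?sqrtr_ge0//.
exact: ltW.
Qed.

Lemma bounded_continuous_linear T (k : R) : linear T ->
  (forall u, sqnorm (T u) <= k * sqnorm u) -> continuous_linear T.
Proof.
move=> Tl Tb; split=> // u; apply/(@cvg_ell2P _ _ _ (nbhs u) _ T).
apply: (@squeeze_cvgr _ (nbhs u) _ R (fun=> 0) (fun v => k * sqnorm (v - u))).
- by apply: nearW => v; rewrite sqnorm_ge0 -linear_funB//= Tb.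
- exact: cvg_cst.
- have /cvg_ell2P : v @[v --> u] --> u by exact: cvg_id.
  by move=> /(cvgMl_tmp (a := k)); rewrite mulr0; exact.
Qed.

Lemma eq_continuous_linear T T' :
  continuous_linear T -> continuous_linear T' ->
  (forall i, T (delta R i) = T' (delta R i)) -> forall u, T u = T' u.
Proof.
move=> TT TT' TE u; apply: ell2P => j.
rewrite !continuous_linear_sum//; congr summability.sum.
by apply/funext => i; rewrite TE.
Qed.

End LinearMaps.

Lemma continuous_linear_comp (R : realType) (I J K : choiceType)
    (S : ell2 R J -> ell2 R K) (T : ell2 R I -> ell2 R J) :
  continuous_linear S -> continuous_linear T -> continuous_linear (S \o T).
Proof.
move=> [Sl Sc] [Tl Tc]; split=> [a u v|u] /=; first by rewrite Tl Sl.
by apply: continuous_comp; [exact: Tc|exact: Sc].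
Qed.

(** * Orthogonal projections *)

Section Completeness.
Variables (R : realType) (I : choiceType).
Local Notation C := (Cplx R).
Local Notation H := (ell2 R I).

Lemma partial_sum_le_sqnorm (u : H) (A : {fset I}) :
  partial_sum (fun i => modulus (u i) ^+ 2) A <= sqnorm u.
Proof. by rewrite -subr_ge0 -sqnorm_truncation sqnorm_ge0. Qed.

Lemma sqsum_le (f : I -> C) (e : R) :
  (forall A, partial_sum (fun i => modulus (f i) ^+ 2) A <= e) ->
  (sqsum f <= e%:E)%E.
Proof.
move=> fe; apply: ge_ereal_sup => _ [X [finX _] <-].
by rewrite fsbig_finite//= sumEFin lee_fin -partial_sum_seq.
Qed.

Lemma cvg_cauchyR (a : nat -> R) :
  (forall e, 0 < e -> exists N, forall n, (N <= n)%N -> (a n - a N) ^+ 2 <= e) ->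
  cvgn a.
Proof.
move=> aC; apply: cauchy_cvg; apply: cauchy_exP => /= e e0.
have [|N aN] := aC ((e / 2) ^+ 2); first by rewrite exprn_gt0// divr_gt0.
exists (a N); exists N => // n /= /aN; rewrite -ball_normE/= => h.
rewrite distrC; apply: (@le_lt_trans _ _ (e / 2)); last first.
  by rewrite gtr_pMr// invf_lt1// ltr1n.
rewrite -sqrtr_sqr -(ger0_norm (ltW (divr_gt0 e0 (ltr0n R 2)))) -sqrtr_sqr.
by rewrite ler_sqrt// sqr_ge0.
Qed.

Lemma cvg_sqrB (x : R) (a : nat -> R) : cvgn a ->
  (x - a n) ^+ 2 @[n --> \oo] --> (x - limn a) ^+ 2.
Proof.
move=> ca; have h : x - a n @[n --> \oo] --> x - limn a.
  by apply: cvgB; [exact: cvg_cst|exact: ca].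
exact: (cvgM h h).
Qed.

Lemma ReB (z w : C) : complex.Re (z - w) = complex.Re z - complex.Re w.
Proof. by case: z w => [? ?] [? ?]. Qed.

Lemma ImB (z w : C) : complex.Im (z - w) = complex.Im z - complex.Im w.
Proof. by case: z w => [? ?] [? ?]. Qed.

(** The coordinates converge, real and imaginary parts separately. The Cauchy bound on finite
    partial sums of [|u m - u n|^2] survives the limit in [n], which yields both membership of the
    limit in l^2 and convergence in norm. *)
Lemma ell2_complete (u : nat -> H) :
  (forall e, 0 < e -> exists N, forall m n, (N <= m)%N -> (N <= n)%N ->
     sqnorm (u m - u n) <= e) ->
  exists l : H, u @ \oo --> l.
Proof.
move=> uC.
have coordC i e : 0 < e -> exists N, forall n, (N <= n)%N ->
    modulus (u n i - u N i) ^+ 2 <= e.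
  move=> /uC[N uN]; exists N => n Nn; apply: le_trans (uN _ _ Nn (leqnn N)).
  exact: (sqnorm_coord_le (u n - u N)).
have cRe i : cvgn (fun n => complex.Re (u n i)).
  apply: cvg_cauchyR => e /(coordC i)[N uN]; exists N => n /uN.
  by rewrite modulus_sqr ReB; apply: le_trans; rewrite lerDl sqr_ge0.
have cIm i : cvgn (fun n => complex.Im (u n i)).
  apply: cvg_cauchyR => e /(coordC i)[N uN]; exists N => n /uN.
  by rewrite modulus_sqr ImB; apply: le_trans; rewrite lerDr sqr_ge0.
pose l i : C := (limn (fun n => complex.Re (u n i)) +i*
                 limn (fun n => complex.Im (u n i)))%C.
have lim_le e : 0 < e -> exists N, forall m, (N <= m)%N ->
    forall A, partial_sum (fun i => modulus (u m i - l i) ^+ 2) A <= e.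
  move=> /uC[N uN]; exists N => m Nm A.
  have cA : (fun n => partial_sum (fun i => modulus (u m i - u n i) ^+ 2) A)
      @ \oo --> partial_sum (fun i => modulus (u m i - l i) ^+ 2) A.
    rewrite partial_sum_seq; under eq_cvg do rewrite partial_sum_seq.
    apply: cvg_big => [|i _]; first exact: add_continuous.
    under eq_cvg do rewrite modulus_sqr ReB ImB.
    rewrite modulus_sqr ReB ImB.
    apply: cvgD; [exact: cvg_sqrB (cRe i)|exact: cvg_sqrB (cIm i)].
  rewrite -(cvg_lim _ cA)//; apply: limr_le; first by apply/cvg_ex; eexists; exact: cA.
  exists N => // n /= Nn; apply: le_trans (uN _ _ Nm Nn).
  exact: (partial_sum_le_sqnorm (u m - u n)).
(* [l] is the difference of [u N] and [u N - l], both square summable. *)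
have lS : l \in @square_summable R I.
  have [N /(_ N (leqnn N)) uN] := lim_le 1 ltr01.
  have dS : (fun i => u N i - l i) \in @square_summable R I.
    by apply/asboolP; apply: le_lt_trans (sqsum_le uN) _; rewrite ltry.
  rewrite (_ : l = u N - Ell2 dS); first by case: (u N - Ell2 dS).
  by apply/funext => i; rewrite ell2DE ell2NE/= opprB addrC subrK.
exists (Ell2 lS); apply/cvg_ell2P; apply/cvgrPdist_le => e e0.
have [N uN] := lim_le e e0; exists N => // n /= /uN unl.
rewrite sub0r normrN ger0_norm ?sqnorm_ge0// -lee_fin -sqsumE.
exact: sqsum_le.
Qed.

End Completeness.

Section Projection.
Variables (R : realType) (I : choiceType).
Local Notation C := (Cplx R).
Local Notation H := (ell2 R I).

Definition subspace (E : set H) :=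
  E 0 /\ forall (c : C) u v, E u -> E v -> E (c *: u + v).

Definition adherent (E : set H) (u : H) :=
  forall e : R, 0 < e -> exists2 w, E w & sqnorm (w - u) < e.

Lemma sqnormD_le (u v : H) : sqnorm (u + v) <= 2 * (sqnorm u + sqnorm v).
Proof.
have := sqsumD_le u v (@ltr01 R); rewrite !sqsumE invr1.
rewrite [X in (X <= _)%E -> _](sqsumE (u + v)).
by rewrite -!EFinM -EFinD lee_fin -mulrDr.
Qed.

Lemma modulus_sqrD_le (z w : C) :
  modulus (z + w) ^+ 2 <= 2 * (modulus z ^+ 2 + modulus w ^+ 2).
Proof.
rewrite !modulus_sqr; case: z w => [a b] [c d] /=.
rewrite -subr_ge0 [X in 0 <= X](_ : _ = (a - c) ^+ 2 + (b - d) ^+ 2).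
  by rewrite addr_ge0 ?sqr_ge0.
ring.
Qed.

Lemma eq0_le_eps (a : R) : 0 <= a -> (forall e, 0 < e -> a <= e) -> a = 0.
Proof.
move=> a0 h; apply/eqP; rewrite eq_le a0 andbT leNgt; apply/negP => agt.
have := h (a / 2) (divr_gt0 agt (ltr0n _ 2)); rewrite leNgt.
by rewrite gtr_pMr// invf_lt1// ltr1n.
Qed.

Lemma adherent_subspace (E : set H) : subspace E -> subspace (adherent E).
Proof.
move=> [E0 El]; split=> [e e0|c u v uE vE e e0].
  by exists 0 => //; rewrite subr0 sqnorm0.
have k0 : 0 < modulus c ^+ 2 + 1 by rewrite ltr_wpDl// sqr_ge0.
(* [sqnormD_le] costs a factor 2, so each of the two terms must stay below [e / 4]; the factor
   [modulus c ^+ 2 + 1] absorbs the scaling by [c] even when [c] is 0. *)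
have [|u' Eu' uu'] := uE (e / 4 / (modulus c ^+ 2 + 1)).
  by rewrite !divr_gt0.
have [|v' Ev' vv'] := vE (e / 4); first by rewrite divr_gt0.
exists (c *: u' + v'); first exact: El.
rewrite opprD addrACA -scalerBr; apply: le_lt_trans (sqnormD_le _ _) _.
rewrite sqnormZ; move: uu'; rewrite ltr_pdivlMr// => uu'.
have := sqnorm_ge0 (u' - u); have := sqr_ge0 (modulus c).
set a := sqnorm (u' - u) in uu' *; set b := sqnorm (v' - v) in vv' *.
set k := modulus c ^+ 2 in uu' *.
by move=> ? ?; nra.
Qed.

Lemma orthogonal_adherent (E : set H) (u v : H) :
  (forall w, E w -> inner u w = 0) -> adherent E v -> inner u v = 0.
Proof.
move=> uE vE; apply: modulus_eq0; apply/eqP; rewrite -sqrf_eq0; apply/eqP.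
apply: eq0_le_eps => [|e e0]; first exact: sqr_ge0.
(* The [+ 1] covers [u = 0]; below, Cauchy-Schwarz leaves the factor [sqnorm u / (sqnorm u + 1)],
   which is at most 1. *)
have k0 : 0 < sqnorm u + 1 by rewrite ltr_wpDl// sqnorm_ge0.
have [|w Ew wv] := vE (e / (sqnorm u + 1)); first by rewrite divr_gt0.
have -> : inner u v = inner u (v - w) by rewrite innerBr (uE w Ew) subr0.
apply: le_trans (Cauchy_Schwarz _ _) _; rewrite sqnorm_subC.
move: wv; rewrite ltr_pdivlMr//.
have := sqnorm_ge0 u; have := sqnorm_ge0 (w - v).
set a := sqnorm _; set b := sqnorm _; nra.
Qed.

(* Compare [u] with [u - c *: v] for [c = <u, v> / |v|^2]. *)
Lemma almost_orthogonal (E : set H) (d t : R) (u : H) : subspace E ->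
  (forall w, E w -> d <= sqnorm (u - w)) -> sqnorm u < d + t ->
  forall v, E v -> modulus (inner u v) ^+ 2 <= t * sqnorm v.
Proof.
move=> [E0 El] dE ud v Ev.
have [v0|v0] := eqVneq (sqnorm v) 0.
  rewrite (sqnorm_eq0 v0) innerC inner0l conjC0 modulus0 expr0n/=.
  by rewrite sqnorm0 mulr0.
have vgt : 0 < sqnorm v by rewrite lt_def v0 sqnorm_ge0.
set c := inner u v / (sqnorm v)%:C%C.
have := dE (c *: v); rewrite -[c *: v]addr0 => /(_ (El _ _ _ Ev E0)).
rewrite addr0.
have -> : sqnorm (u - c *: v) = sqnorm u - modulus (inner u v) ^+ 2 / sqnorm v.
  apply: complexI; rewrite sqnormB -(inner_sqnorm (c *: v)).
  rewrite !innerZl !innerZr inner_sqnorm.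
  have := modulus_sqrE (inner u v); set m := modulus _ ^+ 2 => mE; clearbody m.
  have vC0 : ((sqnorm v)%:C)%C != 0 :> C.
    by apply: contraNneq v0 => /complexI ->.
  have rC : ((sqnorm v)%:C%C : C)^* = (sqnorm v)%:C%C.
    by rewrite -inner_sqnorm -innerC.
  rewrite rmorphB [X in _ = _ - X]fmorph_div/= mE /c !(rmorphM, fmorphV)/= !conjCK !rC.
  move: vC0; set b := ((sqnorm v)%:C)%C; set a := ((sqnorm u)%:C)%C.
  by move: (inner u v) ((inner u v)^*) => z z' b0; field.
by rewrite -ler_pdivrMr// => h; lra.
Qed.

(** The point is the limit of a minimizing sequence [w]. That [w] is Cauchy follows from
    [almost_orthogonal]: [w m - w n] is in [E] and is the difference of [u - w n] and [u - w m],
    both almost orthogonal to [E]. *)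
Lemma projection_point (E : set H) (u : H) : subspace E ->
  exists2 p, adherent E p & forall v, E v -> inner (u - p) v = 0.
Proof.
move=> Es; have [E0 El] := Es.
pose S := [set sqnorm (u - w) | w in E]; pose d := inf S.
have Sinf : has_inf S.
  split; first by exists (sqnorm (u - 0)), 0.
  by exists 0 => _ [w _ <-]; exact: sqnorm_ge0.
have dE w : E w -> d <= sqnorm (u - w).
  by move=> Ew; apply: ge_inf; [exact: Sinf.2|exists w].
have /choice[w wP] : forall n : nat, exists w,
    E w /\ sqnorm (u - w) < d + n.+1%:R^-1.
  move=> n; have [|_ [w Ew <-] ?] := @inf_adherent _ S n.+1%:R^-1 _ Sinf.
    by rewrite invr_gt0.
  by exists w.
(* Translation by [w n] preserves [E], so [u - w n] has the same distance to [E] as [u]. *)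
have almost n v : E v ->
    modulus (inner (u - w n) v) ^+ 2 <= n.+1%:R^-1 * sqnorm v.
  have [Ew wn] := wP n; apply: almost_orthogonal Es _ wn v => w' Ew'.
  rewrite -addrA -opprD; apply: dE.
  by have := El 1 _ _ Ew Ew'; rewrite scale1r.
have Einv n (N : nat) : (N <= n)%N -> n.+1%:R^-1 <= N.+1%:R^-1 :> R.
  by move=> Nn; rewrite lef_pV2 ?posrE// ler_nat.
have invE (e : R) : 0 < e -> exists N : nat, N.+1%:R^-1 <= e.
  move=> e0; exists (Num.truncn e^-1); rewrite invf_ple ?posrE//.
  exact/ltW/truncnS_gt.
have [|p wp] := @ell2_complete R I w.
  move=> e e0; have [|N Ne] := invE (e / 4); first by rewrite divr_gt0.
  exists N => m n Nm Nn.
  have Emn : E (w m - w n).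
    by have := El (-1) _ _ (wP n).1 (wP m).1; rewrite scaleN1r addrC.
  have hm := almost m _ Emn; have hn := almost n _ Emn.
  (* With [s = sqnorm (w m - w n)] this reads [s^2 <= 2 (a + b)], where [a] and [b] are at most
     [e s / 4]; hence [s <= e]. *)
  have := modulus_sqrD_le (inner (u - w n) (w m - w n))
    (- inner (u - w m) (w m - w n)).
  rewrite -innerBl opprB [u - _ + _]addrC addrA subrK modulusN inner_sqnorm.
  rewrite {1}/modulus/= expr0n/= addr0 sqrtr_sqr ger0_norm ?sqnorm_ge0//.
  move: hm hn (Einv _ _ Nm) (Einv _ _ Nn) (sqnorm_ge0 (w m - w n)).
  set s := sqnorm _; set a := modulus _ ^+ 2; set b := modulus _ ^+ 2.
  move=> hm hn lm ln s0 sab.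
  have hm' := le_trans hm (ler_wpM2r s0 (le_trans lm Ne)).
  have hn' := le_trans hn (ler_wpM2r s0 (le_trans ln Ne)).
  rewrite leNgt; apply/negP => es.
  have : s * e < s * s by rewrite ltr_pM2l// (lt_trans e0 es).
  by rewrite -expr2; lra.
have wpe (e : R) : 0 < e -> exists n : nat,
    sqnorm (w n - p) < e /\ n.+1%:R^-1 <= e.
  move=> e0; have [M Me] := invE e e0.
  move/cvg_ell2P/cvgrPdist_lt/(_ _ e0) : wp => [N _ /= Nw].
  exists (maxn M N); split; last by apply: le_trans Me; apply: Einv; exact: leq_maxl.
  have := Nw (maxn M N) (leq_maxr _ _).
  by rewrite sub0r normrN ger0_norm ?sqnorm_ge0.
exists p.
  by move=> e /wpe[n [? _]]; exists (w n) => //; exact: (wP n).1.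
move=> v Ev; apply: modulus_eq0; apply/eqP; rewrite -sqrf_eq0; apply/eqP.
apply: eq0_le_eps => [|e e0]; first exact: sqr_ge0.
have k0 : 0 < sqnorm v + 1 by rewrite ltr_wpDl// sqnorm_ge0.
have [|n [np ne]] := wpe (e / (sqnorm v + 1) / 4); first by rewrite !divr_gt0.
(* [u - p] splits into [u - w n], handled by almost orthogonality, and [w n - p], handled by
   Cauchy-Schwarz. *)
have := modulus_sqrD_le (inner (u - w n) v) (inner (w n - p) v).
rewrite -innerDl addrA subrK => /le_trans; apply.
have := almost n _ Ev; have := Cauchy_Schwarz (w n - p) v.
have ek : e / (sqnorm v + 1) * (sqnorm v + 1) = e by rewrite divfK ?gt_eqF.
have ek0 : 0 < e / (sqnorm v + 1) by rewrite divr_gt0.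
move: np ne ek ek0 (sqnorm_ge0 v) (sqnorm_ge0 (w n - p)).
set q := e / _; set s := sqnorm v; set t := sqnorm _.
set a := modulus _ ^+ 2; set b := modulus _ ^+ 2.
move=> tq rq qe q0 s0 t0 bt ar.
have := le_trans bt (ler_wpM2r s0 (ltW tq)).
have := le_trans ar (ler_wpM2r s0 rq).
by move: qe q0; rewrite mulrDr mulr1; lra.
Qed.

(** [p - q] is adherent to [E] and orthogonal to [E], hence orthogonal to itself. *)
Lemma projection_unique (E : set H) (u p q : H) : subspace E ->
  adherent E p -> adherent E q ->
  (forall v, E v -> inner (u - p) v = 0) ->
  (forall v, E v -> inner (u - q) v = 0) -> p = q.
Proof.
move=> Es pE qE pO qO; apply/subr0_eq; apply: sqnorm_eq0; apply: complexI.
rewrite -inner_sqnorm; apply: (orthogonal_adherent (E := E)) => [v Ev|].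
  have -> : p - q = (u - q) - (u - p) by rewrite opprB [RHS]addrC addrA subrK.
  by rewrite innerBl (pO v Ev) (qO v Ev) subrr.
have [_] := adherent_subspace Es; move=> /(_ (-1) q p qE pE).
by rewrite scaleN1r addrC.
Qed.

(** Uniqueness makes the chosen points linear in [u], and [|u - P u|^2 = |u|^2 - |P u|^2] bounds [P]
    by 1. *)
Lemma projection_exists (E : set H) : subspace E ->
  exists P : H -> H, [/\ continuous_linear P, forall u, adherent E (P u) &
    forall u v, E v -> inner (u - P u) v = 0].
Proof.
move=> Es; have /choice[P PP] : forall u, exists p, adherent E p /\
    forall v, E v -> inner (u - p) v = 0.
  by move=> u; have [p ? ?] := projection_point u Es; exists p.
exists P; split; [|by move=> u; exact: (PP u).1|by move=> u; exact: (PP u).2].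
apply: (@bounded_continuous_linear _ _ _ _ 1) => [c u v|u].
  apply: (projection_unique (u := c *: u + v) Es).
  - exact: (PP _).1.
  - by apply: (adherent_subspace Es).2; exact: (PP _).1.
  - exact: (PP _).2.
  - move=> w Ew; rewrite opprD addrACA -scalerBr innerDl innerZl.
    by rewrite !(PP _).2// mulr0 addr0.
rewrite mul1r -subr_ge0; have := sqnorm_ge0 (u - P u); congr (_ <= _).
apply: complexI; rewrite sqnormB rmorphB/=.
have uP : inner u (P u) = (sqnorm (P u))%:C%C.
  rewrite -inner_sqnorm; apply/subr0_eq; rewrite -innerBl.
  exact: orthogonal_adherent (PP u).2 (PP u).1.
rewrite uP [X in _ - X = _](_ : _ = (sqnorm (P u))%:C%C) ?addrK//.
by rewrite -inner_sqnorm -innerC.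
Qed.

End Projection.

(** * Amplifications *)

Section InnerContinuity.
Variables (R : realType) (I : choiceType).
Local Notation C := (Cplx R).
Local Notation H := (ell2 R I).

Lemma cvg_innerl (T : Type) (F : set_system T) {FF : Filter F} (f : T -> H)
    (l v : H) :
  f @ F --> l -> (fun x => inner (f x) v) @ F --> inner l v.
Proof.
move=> /cvg_ell2P/cvgrPdist_lt fl; apply/cvgrPdist_le => _ /Cplx_gt0[e e0 ->].
have k0 : 0 < sqnorm v + 1 by rewrite ltr_wpDl// sqnorm_ge0.
have ek0 : 0 < e ^+ 2 / (sqnorm v + 1) by rewrite divr_gt0// exprn_gt0.
apply: filterS (fl _ ek0) => x.
rewrite sub0r normrN ger0_norm ?sqnorm_ge0// ltr_pdivlMr// => fxl.
rewrite -innerBl modulusE lecR -(ger0_norm (modulus_ge0 _)) -(ger0_norm (ltW e0)).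
rewrite -!sqrtr_sqr ler_sqrt ?sqr_ge0//; apply: le_trans (Cauchy_Schwarz _ _) _.
rewrite sqnorm_subC; apply: ltW; apply: le_lt_trans fxl.
by rewrite ler_wpM2l ?sqnorm_ge0// lerDl.
Qed.

Lemma eq_inner_cvg (F : H -> C) (v : H) :
  (forall (c : C) u w, F (c *: u + w) = c * F u + F w) ->
  (forall u, F @ u --> F u) ->
  (forall i, F (delta R i) = inner (delta R i) v) ->
  forall u, F u = inner u v.
Proof.
move=> Fl Fc FE u.
have F0 : F 0 = 0.
  apply: (addrI (F 0)); have := Fl 1 0 0.
  by rewrite scale1r mul1r addr0 => <-; rewrite addr0.
apply: (@cvg_unique _ (@norm_hausdorff _ _) (F \o truncation u @ totally)).
  exact: (cvg_comp _ _ (@cvg_truncation R I u) (Fc u)).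
rewrite (_ : F \o truncation u = (fun w => inner w v) \o truncation u).
  exact: cvg_innerl (@cvg_truncation R I u).
apply/funext => A; rewrite /= /truncation.
elim: (enum_fset A) => [|i s IH]; first by rewrite !big_nil F0 inner0l.
by rewrite !big_cons Fl innerDl innerZl FE IH.
Qed.

End InnerContinuity.

Lemma esum_pair (R : realType) (J I : choiceType) (a : J -> I -> \bar R) :
  (forall j i, 0 <= a j i)%E ->
  \esum_(j in [set: J]) \esum_(i in [set: I]) a j i =
  \esum_(p in [set: J * I]) a p.1 p.2.
Proof.
move=> a0; rewrite esum_esum//; congr esum.
by apply/seteqP; split=> // -[j i].
Qed.

(** Membership in the bicommutant of the family [L], phrased for maps on l^2 of any index set: [bop]
    asks for a group, while amplifications live on a product. *)
Definition bicommutes (R : realType) (X : choiceType) (S : Type)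
    (x : ell2 R X -> ell2 R X) (L : S -> ell2 R X -> ell2 R X) :=
  forall Z : ell2 R X -> ell2 R X, continuous_linear Z ->
    (forall s u, Z (L s u) = L s (Z u)) -> forall u, Z (x u) = x (Z u).

Section Amplification.
Variables (R : realType) (J I : choiceType).
Local Notation C := (Cplx R).
Local Notation H := (ell2 R I).
Local Notation K := (ell2 R (J * I)%type).
Implicit Types (u v : H) (a b : K) (f : J -> H).

Definition glue f : K := insubd (0 : K) (fun p => f p.1 p.2).

(** The default of [insubd] is never taken, since a restriction of a square summable function is
    square summable. *)
Definition slice (j : J) a : H := insubd (0 : H) (fun i => a (j, i)).

Lemma square_summable_pair (g : J * I -> C) :
  sqsum g = \esum_(j in [set: J]) sqsum (fun i => g (j, i)).
Proof.
rewrite /sqsum esum_pair => [|j i]; last by rewrite lee_fin sqr_ge0.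
by apply: eq_esum => -[].
Qed.

Lemma glueE f j i : (\esum_(j in [set: J]) (sqnorm (f j))%:E < +oo)%E ->
  glue f (j, i) = f j i.
Proof.
move=> fS; rewrite /glue.
rewrite [LHS](_ : _ = val (insubd (0 : K) (fun p => f p.1 p.2)) (j, i))//.
rewrite val_insubd ifT//; apply/asboolP; rewrite square_summable_pair.
by apply: le_lt_trans fS; apply: le_esum => k _; rewrite -sqsumE.
Qed.

Lemma sliceE j a i : slice j a i = a (j, i).
Proof.
rewrite /slice [LHS](_ : _ = val (insubd (0 : H) (fun i => a (j, i))) i)//.
rewrite val_insubd ifT//; apply/asboolP.
have := sqsumE a; rewrite [X in X = _ -> _]square_summable_pair => aE.
apply: le_lt_trans (ltry (sqnorm a)); rewrite -aE; apply: esum_ge.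
by exists [set j]; [split=> //; exact: finite_set1|rewrite fsbig_set1].
Qed.

Lemma esum_slice a :
  \esum_(j in [set: J]) (sqnorm (slice j a))%:E = (sqnorm a)%:E.
Proof.
rewrite -sqsumE [RHS]square_summable_pair; apply: eq_esum => j _.
by rewrite -sqsumE; congr sqsum; apply/funext => i; rewrite sliceE.
Qed.

Lemma slice_glue f j : (\esum_(j in [set: J]) (sqnorm (f j))%:E < +oo)%E ->
  slice j (glue f) = f j.
Proof. by move=> fS; apply: ell2P => i; rewrite sliceE glueE. Qed.

Lemma sqnorm_glue f : (\esum_(j in [set: J]) (sqnorm (f j))%:E < +oo)%E ->
  (sqnorm (glue f))%:E = \esum_(j in [set: J]) (sqnorm (f j))%:E.
Proof.
by move=> fS; rewrite -esum_slice; apply: eq_esum => j _; rewrite slice_glue.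
Qed.

Lemma slice_inj a b : (forall j, slice j a = slice j b) -> a = b.
Proof. by move=> ab; apply: ell2P => -[j i]; rewrite -!sliceE ab. Qed.

Lemma slice_linear j : linear (slice j).
Proof.
by move=> c a b; apply: ell2P => i; rewrite ell2DE ell2ZE !sliceE.
Qed.

Lemma sqnorm_slice_le j a : sqnorm (slice j a) <= sqnorm a.
Proof.
rewrite -lee_fin -esum_slice; apply: esum_ge.
by exists [set j]; [split=> //; exact: finite_set1|rewrite fsbig_set1].
Qed.

Lemma slice_continuous_linear j : continuous_linear (slice j).
Proof.
apply: (@bounded_continuous_linear _ _ _ _ 1) => [|a]; first exact: slice_linear.
by rewrite mul1r sqnorm_slice_le.
Qed.

Definition embed (j : J) u : K := glue (fun k => if k == j then u else 0).

Let esum_embed j u :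
  \esum_(k in [set: J]) (sqnorm (if k == j then u else 0))%:E = (sqnorm u)%:E.
Proof.
rewrite (esumID [set j]) => [|k _]; last by rewrite lee_fin sqnorm_ge0.
rewrite setTI esum_set1 ?eqxx ?lee_fin ?sqnorm_ge0//.
rewrite esum1 ?adde0// => k [_ /eqP/negPf ->].
by rewrite sqnorm0.
Qed.

Lemma slice_embed k j u : slice k (embed j u) = if k == j then u else 0.
Proof. by rewrite slice_glue// esum_embed ltry. Qed.

Lemma sqnorm_embed j u : sqnorm (embed j u) = sqnorm u.
Proof.
by apply: EFin_inj; rewrite sqnorm_glue ?esum_embed// ltry.
Qed.

Lemma embed_continuous_linear j : continuous_linear (embed j).
Proof.
apply: (@bounded_continuous_linear _ _ _ _ 1) => [c u v|u].
  apply: slice_inj => k; rewrite slice_linear !slice_embed.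
  by case: eqP => // _; rewrite scaler0 addr0.
by rewrite mul1r sqnorm_embed.
Qed.

Lemma delta_embed j i : delta R (j, i) = embed j (delta R i).
Proof.
apply: ell2P => -[k l]; rewrite -[RHS]sliceE slice_embed deltaE xpair_eqE.
by case: eqP => //= _; rewrite deltaE.
Qed.

(** [embed j] and [slice j] are adjoint; by continuity it is enough to test basis vectors. *)
Lemma inner_embed j u b : inner (embed j u) b = inner u (slice j b).
Proof.
have [el ec] := embed_continuous_linear j.
apply: (eq_inner_cvg (F := fun u => inner (embed j u) b)) => [c v w|v|i].
- by rewrite el innerDl innerZl.
- exact: cvg_innerl (ec v).
- by rewrite -delta_embed innerC inner_delta innerC inner_delta sliceE.
Qed.

(* The operator [1 (x) T] on [l^2(J) (x) l^2(I) = l^2(J * I)]; [glue] returns 0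
   when the family is not square summable, which cannot happen for bounded [T]. *)
Definition amp (T : H -> H) a : K := glue (fun j => T (slice j a)).

Section AmpTheory.
Variable T : H -> H.
Hypothesis TT : continuous_linear T.

Lemma amp_bounded : exists2 k : R, 0 <= k & forall a,
  (\esum_(j in [set: J]) (sqnorm (T (slice j a)))%:E <= (k * sqnorm a)%:E)%E.
Proof.
have [k k0 kT] := continuous_linear_bounded TT; exists k => // a.
rewrite EFinM -esum_slice.
apply: le_trans (esumZ_le k0 _) => [|j]; last exact: sqnorm_ge0.
by apply: le_esum => j _; rewrite lee_fin.
Qed.

Lemma amp_summable a :
  (\esum_(j in [set: J]) (sqnorm (T (slice j a)))%:E < +oo)%E.
Proof.
by have [k _ /(_ a) kT] := amp_bounded; apply: le_lt_trans kT (ltry _).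
Qed.

Lemma slice_amp j a : slice j (amp T a) = T (slice j a).
Proof. by rewrite slice_glue//; exact: amp_summable. Qed.

Lemma amp_continuous_linear : continuous_linear (amp T).
Proof.
have [k _ kT] := amp_bounded.
apply: (@bounded_continuous_linear _ _ _ _ k) => [c a b|a].
  by apply: slice_inj => j; rewrite slice_linear !slice_amp slice_linear TT.1.
by rewrite -lee_fin sqnorm_glue//; exact: amp_summable.
Qed.

Lemma amp_embed j u : amp T (embed j u) = embed j (T u).
Proof.
apply: slice_inj => k; rewrite slice_amp !slice_embed.
by case: eqP => // _; rewrite (linear_fun0 TT.1).
Qed.

Lemma amp_isometry : (forall u, sqnorm (T u) = sqnorm u) ->
  forall a, sqnorm (amp T a) = sqnorm a.
Proof.
move=> Ti a; apply: EFin_inj; rewrite sqnorm_glue ?amp_summable// -esum_slice.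
by apply: eq_esum => j _; rewrite Ti.
Qed.

End AmpTheory.

(** View [Z] as a block matrix. Each block [slice j \o Z \o embed i] commutes with every [L s],
    hence with [x], and [amp x] is block diagonal with [x] in every diagonal block. *)
Lemma amp_bicommutes (S : Type) (x : H -> H) (L : S -> H -> H) :
  continuous_linear x -> (forall s, continuous_linear (L s)) ->
  bicommutes x L -> bicommutes (amp x) (fun s => amp (L s)).
Proof.
move=> xc Lc xL Z Zc ZL.
have ac := amp_continuous_linear xc.
have blocks j i u : slice j (Z (embed i (x u))) = x (slice j (Z (embed i u))).
  apply: (xL (fun u => slice j (Z (embed i u)))) => [|s v].
    exact: (continuous_linear_comp (slice_continuous_linear j)
             (continuous_linear_comp Zc (embed_continuous_linear i))).
  by rewrite -(amp_embed (Lc s)) ZL slice_amp.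
apply: eq_continuous_linear.
- exact: continuous_linear_comp Zc ac.
- exact: continuous_linear_comp ac Zc.
move=> [i k]; rewrite delta_embed amp_embed//; apply: slice_inj => j.
by rewrite blocks slice_amp.
Qed.

End Amplification.

(** * The bicommutant argument *)

Section Density.
Variables (R : realType) (I : choiceType) (S : Type).
Local Notation C := (Cplx R).
Local Notation H := (ell2 R I).

Lemma isometry_inner (T : H -> H) : linear T ->
  (forall u, sqnorm (T u) = sqnorm u) ->
  forall u v, inner (T u) (T v) = inner u v.
Proof.
move=> Tl Ti u v; rewrite !innerE /polarization.
rewrite -(linear_funD _ _ Tl) -(linear_funB _ _ Tl) !Ti.
have TZ (c : C) w : c *: T w = T (c *: w).
  by have := Tl c w 0; rewrite (linear_fun0 Tl) !addr0.
by rewrite TZ -(linear_funD _ _ Tl) -(linear_funB _ _ Tl) !Ti.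
Qed.

(* The projection onto the closure of an invariant subspace commutes with
   every [L s], hence with [x]. *)
Lemma bicommutes_adherent (x : H -> H) (L L' : S -> H -> H) (E : set H) (f : H) :
  bicommutes x L -> (forall s, continuous_linear (L s)) ->
  (forall s u, sqnorm (L s u) = sqnorm u) ->
  (forall s u, L s (L' s u) = u) ->
  subspace E -> (forall s u, E u -> E (L s u)) ->
  (forall s u, E u -> E (L' s u)) ->
  E f -> adherent E (x f).
Proof.
move=> xL Lc Li LL' Es EL EL' Ef.
have [P [Pc PE PO]] := projection_exists Es.
have Pf : P f = f.
  apply: (projection_unique (u := f) Es (PE f)).
  - by move=> e e0; exists f => //; rewrite subrr sqnorm0.
  - exact: PO.
  - by move=> v Ev; rewrite subrr inner0l.
have PL s u : P (L s u) = L s (P u).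
  apply: (projection_unique (u := L s u) Es (PE _)).
  - move=> e e0; have [w Ew wu] := PE u e e0.
    by exists (L s w); [exact: EL|rewrite -(linear_funB _ _ (Lc s).1) Li].
  - exact: PO.
  (* Writing [v] as [L s (L' s v)], the isometry [L s] cancels from the inner product, and [L' s v]
     is again in [E]. *)
  - move=> v Ev; rewrite -(linear_funB _ _ (Lc s).1) -(LL' s v).
    rewrite (isometry_inner (Lc s).1)//; apply: PO; exact: EL'.
by rewrite -{1}Pf -xL//.
Qed.

End Density.

(** * Inner products on a countable direct sum *)

Section NormalFunctional.
Variables (R : realType) (I : choiceType).
Local Notation C := (Cplx R).
Local Notation K := (ell2 R (nat * I)%type).

Lemma slice_sum_embed (w : nat -> ell2 R I) (N n : nat) :
  slice n (\sum_(0 <= m < N) embed m (w m)) = if (n < N)%N then w n else 0.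
Proof.
apply: ell2P => i; rewrite sliceE.
have -> : (\sum_(0 <= m < N) embed m (w m)) (n, i) =
    \sum_(0 <= m < N) (if m == n then w m i else 0).
  rewrite ell2_sumE; apply: eq_bigr => m _.
  by rewrite -sliceE slice_embed eq_sym; case: eqP.
by rewrite -big_mkcond big_nat1_eq/=; case: ifP.
Qed.

(** By Pythagoras the vectors [t N] made of the first [N] slices of [a] converge to [a]. This
    rewrites a series [sum_n <x f_n, g_n>] as one inner product in the amplification. *)
Lemma cvg_series_slice (a b : K) :
  series (fun n => inner (slice n a) (slice n b)) @ \oo --> inner a b.
Proof.
pose t N : K := \sum_(0 <= n < N) embed n (slice n a).
have tE N (w : K) :
    inner (t N) w = \sum_(0 <= n < N) inner (slice n a) (slice n w).
  rewrite /t; elim: N => [|N IH]; first by rewrite !big_geq// inner0l.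
  by rewrite !big_nat_recr//= innerDl IH inner_embed.
have -> : series (fun n => inner (slice n a) (slice n b)) = fun N => inner (t N) b.
  by apply/funext => N; rewrite tE seriesEnat.
apply: cvg_innerl; apply/cvg_ell2P.
have slt N n : (n < N)%N -> slice n (t N) = slice n a.
  by move=> nN; rewrite /t slice_sum_embed nN.
have st N : sqnorm (t N - a) = sqnorm a - \sum_(0 <= n < N) sqnorm (slice n a).
  apply: complexI; rewrite rmorphB rmorph_sum sqnormB -(inner_sqnorm (t N)) !tE.
  have pE : \sum_(0 <= n < N) inner (slice n a) (slice n (t N)) =
      \sum_(0 <= n < N) (sqnorm (slice n a))%:C%C.
    by apply: eq_big_nat => n /andP[_ nN]; rewrite slt// inner_sqnorm.
  have pE' : \sum_(0 <= n < N) inner (slice n a) (slice n a) =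
      \sum_(0 <= n < N) (sqnorm (slice n a))%:C%C.
    by apply: eq_bigr => n _; rewrite inner_sqnorm.
  have pC : (\sum_(0 <= n < N) (sqnorm (slice n a))%:C%C : C)^* =
      \sum_(0 <= n < N) (sqnorm (slice n a))%:C%C.
    by rewrite rmorph_sum; apply: eq_bigr => n _; rewrite /= -inner_sqnorm -innerC.
  by rewrite pE pE' pC/=; ring.
have cS : (fun N => \sum_(0 <= n < N) sqnorm (slice n a)) @ \oo --> sqnorm a.
  have h : (fun N => (\sum_(0 <= n < N) (sqnorm (slice n a))%:E)%E) @ \oo -->
      (sqnorm a)%:E.
    rewrite -esum_slice -nneseries_esumT => [|n]; last by rewrite lee_fin sqnorm_ge0.
    by apply: is_cvg_nneseries => n _ _; rewrite lee_fin sqnorm_ge0.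
  rewrite (_ : (fun N => _) =
      fine \o (fun N => \sum_(0 <= n < N) (sqnorm (slice n a))%:E)%E).
    exact: fine_cvg h.
  by apply/funext => N /=; rewrite sumEFin.
have := cvgB (cvg_cst (sqnorm a)) cS; rewrite subrr.
have -> : (fun N => sqnorm (t N - a)) =
    cst (sqnorm a) \- (fun N => \sum_(0 <= n < N) sqnorm (slice n a)).
  by apply/funext => N; rewrite st.
exact.
Qed.

End NormalFunctional.

(** * Convolution operators *)

Section GroupOperators.
Variables (R : realType) (G : groupType).
Local Notation C := (Cplx R).
Local Notation H := (ell2 R G).
Local Notation B := (bop R G).

Lemma bop_continuous_linear (T : B) : continuous_linear T.
Proof. by split; [exact: bop_linear|exact: bop_continuous]. Qed.

Lemma bopP (S T : B) : (forall u, S u = T u) -> S = T.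
Proof. by move=> ST; apply/val_inj/funext. Qed.

Lemma lambda_delta (s t : G) : lambda R s (delta R t) = delta R (s * t)%g.
Proof.
apply: ell2P => r; rewrite [LHS](_ : _ = delta R t (s^-1 * r)%g)// !deltaE.
by rewrite -(inj_eq (mulgI s)) mulVKg.
Qed.

Lemma lambda_isometry (s : G) (u : H) : sqnorm (lambda R s u) = sqnorm u.
Proof. by rewrite /sqnorm [X in fine X](sqsum_translation s u). Qed.

Lemma lambdaM (s t : G) : lambda R s * lambda R t = lambda R (s * t)%g.
Proof.
apply: bopP => u; apply: ell2P => r.
by rewrite [LHS](_ : _ = u (t^-1 * (s^-1 * r))%g)// mulgA -invgM.
Qed.

Lemma lambda1 : lambda R (1%g : G) = 1.
Proof.
apply: bopP => u; apply: ell2P => r.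
by rewrite [LHS](_ : _ = u (1^-1 * r)%g)// invg1 mul1g.
Qed.

Lemma rtranslation_sqsum (g : G) (u : G -> C) :
  sqsum (fun t => u (t * g)%g) = sqsum u.
Proof.
rewrite /sqsum [RHS](reindex_esum [set: G] [set: G] (fun t : G => (t * g)%g))//.
split=> [//|t t' _ _ /mulIg //|t _]; exists (t * g^-1)%g => //.
by rewrite mulgVK.
Qed.

Lemma rtranslation_subproof (g : G) (u : H) :
  (fun t => u (t * g)%g) \in @square_summable R G.
Proof.
by apply/asboolP; rewrite rtranslation_sqsum; case: u => u /= /asboolP.
Qed.

Definition rtranslation (g : G) (u : H) : H := Ell2 (rtranslation_subproof g u).

Lemma rtranslation_bounded (g : G) : rtranslation g \in @bounded_operator R G.
Proof.
apply/asboolP; apply: (@bounded_continuous_linear _ _ _ _ 1) => [a u v|u].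
  exact: val_inj.
by rewrite mul1r /sqnorm [X in fine X](rtranslation_sqsum g u).
Qed.

Definition rho (g : G) : B := Bop (rtranslation_bounded g).

Lemma rhoE (g : G) (u : H) t : rho g u t = u (t * g)%g. Proof. by []. Qed.

Lemma rho_delta (g t : G) : rho g (delta R t) = delta R (t * g^-1)%g.
Proof.
by apply: ell2P => r; rewrite rhoE !deltaE -[in RHS](inj_eq (mulIg g)) mulgVK.
Qed.

Lemma cutoff_subproof (K : set G) (u : H) :
  (fun t => if t \in K then u t else 0) \in @square_summable R G.
Proof.
apply/asboolP; apply: le_lt_trans (ltry (sqnorm u)); rewrite -sqsumE.
apply: le_esum => t _; rewrite lee_fin; case: ifP => // _.
by rewrite modulus0 expr0n sqr_ge0.
Qed.

Definition cutoff_fun (K : set G) (u : H) : H := Ell2 (cutoff_subproof K u).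

Lemma cutoff_bounded (K : set G) : cutoff_fun K \in @bounded_operator R G.
Proof.
apply/asboolP; apply: (@bounded_continuous_linear _ _ _ _ 1) => [a u v|u].
  apply: ell2P => t; rewrite ell2DE ell2ZE /=.
  by case: ifP => // _; rewrite mulr0 addr0.
rewrite mul1r -lee_fin -!sqsumE; apply: le_esum => t _; rewrite lee_fin /=.
by case: ifP => // _; rewrite modulus0 expr0n sqr_ge0.
Qed.

(** The orthogonal projection onto l^2(K); commuting with it forces the coefficients to be supported
    in [K]. *)
Definition cutoff (K : set G) : B := Bop (cutoff_bounded K).

Lemma cutoffE (K : set G) (u : H) t : cutoff K u t = if t \in K then u t else 0.
Proof. by []. Qed.

Lemma rho_adjoint (g : G) : is_adjoint (rho g) (rho g^-1%g).
Proof.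
move=> u v; rewrite /inner.
rewrite -(@sum_reindex _ _ _ (fun t => t * g^-1)%g (fun t => t * g)%g) /=.
- by apply/congr1/funext => t; rewrite /= mulgVK.
- by move=> t; rewrite mulgVK.
- by move=> t; rewrite mulgK.
Qed.

Lemma cutoff_adjoint (K : set G) : is_adjoint (cutoff K) (cutoff K).
Proof.
move=> u v; rewrite /inner; apply/congr1/funext => t; rewrite !cutoffE.
by case: ifP => // _; rewrite mul0r conjC0 mulr0.
Qed.

Lemma inner_ext (u v : H) : (forall w, inner w u = inner w v) -> u = v.
Proof.
move=> uv; apply: ell2P => t; have := uv (delta R t).
by rewrite innerC [RHS]innerC !inner_delta => /(can_inj conjCK).
Qed.

(** Stability under adjoints comes from moving both operators across the inner product; the second
    half is the identity [S''' = S']. *)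
Lemma von_neumann_commutant (S : set B) :
  (forall x, S x -> exists2 y, S y & is_adjoint y x) ->
  von_neumann_algebra (commutant S).
Proof.
move=> Sadj; split.
  move=> x y xS xy t /Sadj[t' St' tt']; apply: bopP => v; apply: inner_ext => u.
  transitivity (inner ((x * t') u) v).
    rewrite (xS _ St') [RHS](_ : _ = inner (t' (x u)) v)// tt' xy.
    by [].
  by rewrite [LHS](_ : _ = inner (x (t' u)) v)// xy tt'.
apply/seteqP; split=> [x xS y Sy|x xS y yS].
  by apply: xS => z zS; rewrite zS.
by rewrite yS.
Qed.

(** The commutant of the [rho g] and [cutoff K] is a von Neumann algebra, and by the invariance of
    [K] it contains the generators [lambda R k]. *)
Lemma vn_translations_commute (K : set G) (x : B) :
  (forall k s, K k -> (k^-1 * s)%g \in K = (s \in K)) ->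
  vn_translations K x ->
  (forall g, x * rho g = rho g * x) /\ x * cutoff K = cutoff K * x.
Proof.
move=> Kl xK.
pose S : set B := [set y | (exists g, y = rho g) \/ y = cutoff K].
suff xS : commutant S x by split=> [g|]; apply: xS; [left; exists g|right].
apply: xK; split.
  apply: von_neumann_commutant => _ [[g ->]|->].
    exists (rho g^-1%g); first by left; exists g^-1%g.
    by have := rho_adjoint g^-1; rewrite invgK.
  by exists (cutoff K); [right|exact: cutoff_adjoint].
move=> _ [k Kk <-] _ [[g ->]|->]; apply: bopP => u; apply: ell2P => t.
  by rewrite [LHS](_ : _ = u (k^-1 * t * g)%g)// -mulgA.
rewrite [LHS](_ : _ = if (k^-1 * t)%g \in K then u (k^-1 * t)%g else 0)//.
by rewrite Kl.
Qed.

(** Left convolution by the vector [x (delta R 1%g)]: the matrix form of commutation with right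
    translations. *)
Definition convolver (x : H -> H) := continuous_linear x /\
  forall s t, x (delta R t) s = x (delta R 1%g) (s * t^-1)%g.

Lemma convolver_rho (x : B) : (forall g, x * rho g = rho g * x) -> convolver x.
Proof.
move=> xr; split; first exact: bop_continuous_linear.
move=> s t; have /(congr1 (fun y : B => y (delta R 1%g) s)) := xr t^-1%g.
rewrite [X in X = _ -> _](_ : _ = x (rho t^-1%g (delta R 1%g)) s)//.
by rewrite rho_delta mul1g invgK => ->.
Qed.

(* Both composites have the matrix entry
   [\sum_k x(k) * z(k^-1 * s, t)], by reindexing [x(r * t^-1)] with [r = k * t]
   and [x(s * r^-1)] with [r = k^-1 * s]. *)
Lemma convolver_commute (K : set G) (x z : H -> H) :
  convolver x -> (forall s, x (delta R 1%g) s != 0 -> K s) ->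
  continuous_linear z ->
  (forall k u, K k -> z (lambda R k u) = lambda R k (z u)) ->
  forall u, z (x u) = x (z u).
Proof.
move=> [xc xE] xK zc zK; apply: eq_continuous_linear.
- exact: continuous_linear_comp zc xc.
- exact: continuous_linear_comp xc zc.
move=> t; apply: ell2P => s; rewrite !continuous_linear_sum//.
rewrite -(@sum_reindex _ _ _ (fun k => k * t)%g (fun r => r * t^-1)%g); last 2 first.
- by move=> k; rewrite mulgK.
- by move=> k; rewrite mulgVK.
rewrite -[RHS](@sum_reindex _ _ _ (fun k => k^-1 * s)%g (fun r => s * r^-1)%g); last 2 first.
- by move=> k; rewrite invgM invgK mulgA mulgV mul1g.
- by move=> k; rewrite invgM invgK mulgVK.
congr summability.sum; apply/funext => k /=.
rewrite xE mulgK [in RHS]xE invgM invgK mulgA mulgV mul1g.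
have [->|xk0] := eqVneq (x (delta R 1%g) k) 0; first by rewrite mul0r mulr0.
by rewrite -lambda_delta (zK _ _ (xK _ xk0)) mulrC.
Qed.

Lemma convolver_comp_coef (x y : H -> H) (s : G) : convolver x ->
  x (y (delta R 1%g)) s =
  summability.sum (fun r => y (delta R 1%g) r * x (delta R 1%g) (s * r^-1)%g).
Proof.
move=> [xc xE]; rewrite continuous_linear_sum//; congr summability.sum.
by apply/funext => r; rewrite xE.
Qed.

Lemma convolver_eq (x y : H -> H) : convolver x -> convolver y ->
  x (delta R 1%g) = y (delta R 1%g) -> forall u, x u = y u.
Proof.
move=> [xc xE] [yc yE] xy; apply: eq_continuous_linear => // t.
by apply: ell2P => s; rewrite xE yE xy.
Qed.

End GroupOperators.

(** * Fourier coefficients and the subalgebra of a subgroup *)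

Section FourierCoefficients.
Variables (R : realType) (G : groupType).
Local Notation C := (Cplx R).
Local Notation H := (ell2 R G).
Local Notation VN := (group_vn R G).
Implicit Types x y : VN.

Lemma group_vnP x : vn_translations [set: G] (\val x).
Proof. by case: x => x /= /asboolP. Qed.

Lemma group_vn_convolver x : convolver (\val x).
Proof.
apply: convolver_rho; apply: (proj1 (vn_translations_commute _ (group_vnP x))).
by move=> k s _; rewrite !in_setT.
Qed.

(** The trace reads off the matrix entry in row [1] and column [s^-1], which right invariance moves
    to row [s] and column [1]. *)
Lemma fourier_coefE x s : fourier_coef x s = \val x (delta R 1%g) s.
Proof.
rewrite /fourier_coef /trace inner_delta.
rewrite [LHS](_ : _ = \val x (lambda R s^-1%g (delta R 1%g)) 1%g)//.
by rewrite lambda_delta mulg1 (group_vn_convolver x).2 invgK mul1g.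
Qed.

Lemma fourier_coefM x y s : fourier_coef (x * y) s =
  summability.sum (fun r => fourier_coef y r * fourier_coef x (s * r^-1)%g).
Proof.
rewrite fourier_coefE.
rewrite [LHS](_ : _ = \val x (\val y (delta R 1%g)) s)//.
rewrite convolver_comp_coef; last exact: group_vn_convolver.
by congr summability.sum; apply/funext => r; rewrite !fourier_coefE.
Qed.

Lemma fourier_coef_inj x y :
  (forall s, fourier_coef x s = fourier_coef y s) -> x = y.
Proof.
move=> xy; apply/val_inj/bopP; apply: convolver_eq.
- exact: group_vn_convolver.
- exact: group_vn_convolver.
- by apply: ell2P => s; rewrite -!fourier_coefE.
Qed.

Lemma fourier_coef_lambda s t : fourier_coef (vn_lambda R s) t = (t == s :> G)%:R.
Proof.
rewrite fourier_coefE [LHS](_ : _ = lambda R s (delta R 1%g) t)//.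
by rewrite lambda_delta mulg1 deltaE.
Qed.

Lemma fourier_coef_linear s : linear ((fun x => fourier_coef x s) : VN -> C^o).
Proof. by move=> c x y; rewrite !fourier_coefE. Qed.

Lemma fourier_coefZ (c : C) x s : fourier_coef (c *: x) s = c * fourier_coef x s.
Proof. by rewrite !fourier_coefE. Qed.

Lemma vn_subalgebraP (K : set G) x :
  (forall k s, K k -> (k^-1 * s)%g \in K = (s \in K)) -> K 1%g ->
  vn_subalgebra K x <-> forall s, fourier_coef x s != 0 -> K s.
Proof.
move=> Kl K1; split=> [xK s|xK].
  have [_ /(congr1 (fun y : bop R G => y (delta R 1%g) s))] :=
    vn_translations_commute Kl xK.
  rewrite [X in X = _ -> _](_ : _ = \val x (cutoff R K (delta R 1%g)) s)//.
  (* As [K] contains [1], the projection fixes [delta R 1%g]; commutation then makes it fix the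
     coefficient vector of [x]. *)
  have -> : cutoff R K (delta R 1%g) = delta R 1%g.
    apply: ell2P => t; rewrite cutoffE deltaE; case: ifPn => // tK.
    by case: eqP => // t1; move: tK; rewrite t1 mem_set.
  rewrite -fourier_coefE => ->.
  rewrite [X in X != _](_ : _ = if s \in K then \val x (delta R 1%g) s else 0)//.
  by case: ifPn => [/set_mem//|_]; rewrite eqxx.
(* [A] equals its bicommutant, so it suffices that [x] commutes with each [z] in the commutant of
   [A]; such a [z] commutes with [lambda R k] for [k] in [K]. *)
move=> A [[Aadj AE] AK]; rewrite -AE => z zA; apply: bopP => u.
rewrite [LHS](_ : _ = \val x (z u))// [RHS](_ : _ = z (\val x u))//.
apply/esym; apply: (convolver_commute (K := K)).
- exact: group_vn_convolver.
- by move=> s; rewrite -fourier_coefE; exact: xK.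
- exact: bop_continuous_linear.
- move=> k v Kk.
  have /(congr1 (fun y : bop R G => y v)) : z * lambda R k = lambda R k * z.
    by apply: zA; apply: AK; exists k.
  by [].
Qed.

End FourierCoefficients.

(** * Weak-star density of the span of the translations *)

Section WeakStar.
Variables (R : realType) (G : groupType).
Local Notation C := (Cplx R).
Local Notation H := (ell2 R G).
Local Notation VN := (group_vn R G).
Local Notation K := (ell2 R (nat * G)%type).
Implicit Types x y : VN.

(* The linear span, as the intersection of all subspaces containing the
   translations. *)
Definition lambda_span : set VN := [set y | forall S : set VN,
  S 0 -> (forall (c : C) u v, S u -> S v -> S (c *: u + v)) ->
  (forall s, S (vn_lambda R s)) -> S y].

Lemma lambda_span0 : lambda_span 0. Proof. by move=> S S0 _ _. Qed.

Lemma lambda_spanP (c : C) x y :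
  lambda_span x -> lambda_span y -> lambda_span (c *: x + y).
Proof.
move=> xD yD S S0 Sl Sv.
exact: (Sl _ _ _ (xD S S0 Sl Sv) (yD S S0 Sl Sv)).
Qed.

Lemma lambda_span_lambda s : lambda_span (vn_lambda R s).
Proof. by move=> S _ _ Sl; exact: Sl. Qed.

Lemma vn_lambdaM (s t : G) : vn_lambda R s * vn_lambda R t = vn_lambda R (s * t)%g.
Proof. apply: val_inj; exact: (lambdaM R s t). Qed.

Lemma vn_lambda1 : vn_lambda R (1%g : G) = 1.
Proof. apply: val_inj; exact: (lambda1 R G). Qed.

Lemma lambda_spanM s y : lambda_span y -> lambda_span (vn_lambda R s * y).
Proof.
move=> yD; apply: (yD [set y | lambda_span (vn_lambda R s * y)]) => /=.
- by rewrite mulr0; exact: lambda_span0.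
- by move=> c u v uD vD; rewrite mulrDr -scalerAr; exact: lambda_spanP.
- by move=> t; rewrite vn_lambdaM; exact: lambda_span_lambda.
Qed.

Lemma group_vn_bicommutes x :
  bicommutes (\val x) (fun s => lambda R s : H -> H).
Proof.
move=> Z Zc ZL; apply: (convolver_commute (K := setT)) => //.
exact: group_vn_convolver.
Qed.

Let vc x : continuous_linear (\val x) := bop_continuous_linear _.
Let lc (s : G) : continuous_linear (lambda R s : H -> H) := bop_continuous_linear _.

Lemma group_vnM x y (u : H) : \val (x * y) u = \val x (\val y u).
Proof. by []. Qed.

Lemma group_vnD (c : C) x y (u : H) :
  \val (c *: x + y) u = c *: \val x u + \val y u.
Proof. by []. Qed.

Lemma group_vn1 (u : H) : \val (1 : VN) u = u. Proof. by []. Qed.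

(* The double amplification handles finitely many vectors of [K] at once, by
   placing them in distinct slices of a single vector. *)
Lemma lambda_span_dense_amp (J J' : choiceType) (x : VN)
    (f : ell2 R (J * (J' * G))%type) (e : R) : 0 < e ->
  exists2 y, lambda_span y & sqnorm (amp (amp (\val y)) f - amp (amp (\val x)) f) < e.
Proof.
move=> e0; pose A (y : VN) := amp (J := J) (amp (J := J') (\val y)).
pose L s := amp (J := J) (amp (J := J') (lambda R s : H -> H)).
have Ac y : continuous_linear (amp (J := J') (\val y)).
  exact: (amp_continuous_linear _ (vc y)).
have Lc s : continuous_linear (amp (J := J') (lambda R s : H -> H)).
  exact: (amp_continuous_linear _ (lc s)).
have AE y j k a : slice k (slice j (A y a)) = \val y (slice k (slice j a)).
  by rewrite (slice_amp (Ac y)) (slice_amp (vc y)).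
have LE s j k a : slice k (slice j (L s a)) = lambda R s (slice k (slice j a)).
  by rewrite (slice_amp (Lc s)) (slice_amp (lc s)).
have Abi : bicommutes (A x) L.
  apply: (amp_bicommutes (Ac x) Lc).
  exact: (amp_bicommutes (vc x) lc (group_vn_bicommutes x)).
have L2c s : continuous_linear (L s) by exact: (amp_continuous_linear _ (Lc s)).
have Li s u : sqnorm (L s u) = sqnorm u.
  apply: (amp_isometry (Lc s)).
  by apply: (amp_isometry (lc s)); exact: lambda_isometry.
suff: exists2 y, lambda_span y & sqnorm (A y f - A x f) < e by [].
clearbody A L.
have slice2_inj (a b : ell2 R (J * (J' * G))%type) :
    (forall j k, slice k (slice j a) = slice k (slice j b)) -> a = b.
  by move=> ab; apply: slice_inj => j; apply: slice_inj => k.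
have LA s y a : L s (A y a) = A (vn_lambda R s * y) a.
  apply: slice2_inj => j k; rewrite LE (AE y).
  by apply/esym/(etrans (AE _ j k a)); rewrite group_vnM.
have Al (c : C) y z a : A (c *: y + z) a = c *: A y a + A z a.
  apply: slice2_inj => j k; apply: etrans (AE _ j k a) _.
  rewrite (slice_linear j c (A y a) (A z a)).
  rewrite (slice_linear k c (slice j (A y a)) (slice j (A z a))).
  by rewrite (AE y) (AE z) group_vnD.
have A1 a : A 1 a = a.
  by apply: slice2_inj => j k; exact: etrans (AE _ j k a) (group_vn1 _).
(* The orbit of [f] under the span: a translation-invariant subspace, containing [f] because [1] is
   the translation by the identity. *)
pose E := [set A y f | y in lambda_span].
have [||||||||_ [y yD <-] h] := @bicommutes_adherent R _ G (A x) L
  (fun s => L s^-1%g) E f _ _ _ _ _ _ _ _ e e0.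
- by [].
- by [].
- by [].
- move=> s u; rewrite -[in LHS](A1 u) !LA mulr1 vn_lambdaM mulgV.
  by rewrite vn_lambda1 A1.
- split.
    exists 0; first exact: lambda_span0.
    by have := Al (-1) 1 1 f; rewrite scaleN1r addNr => ->; rewrite A1 scaleN1r addNr.
  move=> c _ _ [y yD <-] [z zD <-]; exists (c *: y + z); last exact: Al.
  exact: lambda_spanP.
- move=> s _ [y yD <-]; rewrite LA; exists (vn_lambda R s * y) => //.
  exact: lambda_spanM.
- move=> s _ [y yD <-]; rewrite LA; exists (vn_lambda R s^-1%g * y) => //.
  exact: lambda_spanM.
- by exists 1 => //; rewrite -vn_lambda1; exact: lambda_span_lambda.
by exists y.
Qed.

Lemma lambda_span_dense (x : VN) (Fs : seq K) (e : R) : 0 < e ->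
  exists2 y, lambda_span y &
    forall F, F \in Fs -> sqnorm (amp (\val y) F - amp (\val x) F) < e.
Proof.
move=> e0; pose f := \sum_(0 <= i < size Fs) embed i (nth 0 Fs i).
have [y yD yx] := lambda_span_dense_amp x f e0.
exists y => // F FFs; apply: le_lt_trans yx.
have fi : slice (index F Fs) f = F.
  by rewrite /f slice_sum_embed index_mem FFs nth_index.
apply: le_trans (sqnorm_slice_le (index F Fs) _).
rewrite (linear_funB _ _ (slice_linear _)).
have Ac z := @amp_continuous_linear R nat _ _ (vc z).
by rewrite (slice_amp (Ac y)) (slice_amp (Ac x)) fi.
Qed.

(** Supplies the hypothesis of [glueE]: the whole sequence becomes one vector of [K]. *)
Lemma ell2_sequence_summable (f : ell2_sequence R G) :
  (\esum_(n in [set: nat]) (sqnorm (sval f n))%:E < +oo)%E.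
Proof.
case: f => f /= fc.
have [_ /Cplx_gt0[M M0 ->] fM] := pinfty_ex_gt0 (@cvg_seq_bounded C C^o _ fc).
apply: le_lt_trans (ltry M); rewrite -nneseries_esumT => [|n]; last first.
  by rewrite lee_fin sqnorm_ge0.
apply: lime_le.
  by apply: is_cvg_nneseries => n _ _; rewrite lee_fin sqnorm_ge0.
apply: nearW => N; rewrite sumEFin lee_fin.
have := fM N I; rewrite seriesEnat/= => h.
have E : \sum_(0 <= k < N) `|f k| ^+ 2 = (\sum_(0 <= k < N) sqnorm (f k))%:C%C :> C.
  by rewrite rmorph_sum; apply: eq_bigr => k _; rewrite sqr_normE.
rewrite E ger0_norm in h; first by rewrite lecR in h.
by rewrite (lecR 0) sumr_ge0// => k _; exact: sqnorm_ge0.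
Qed.

(** In the countable amplification a normal functional is a single vector functional, hence is
    controlled by strong approximation there. *)
Lemma normal_functionalE (p : ell2_sequence R G * ell2_sequence R G) (y : VN) :
  normal_functional p y =
  inner (amp (\val y) (glue (sval p.1))) (glue (sval p.2)).
Proof.
rewrite /normal_functional; apply: cvg_lim => //.
have := @cvg_series_slice R G (amp (\val y) (glue (sval p.1))) (glue (sval p.2)).
rewrite (_ : (fun n => _) = (fun n => inner (\val y (sval p.1 n)) (sval p.2 n)))//.
apply/funext => n; rewrite slice_amp// !slice_glue//.
- exact: ell2_sequence_summable.
- exact: ell2_sequence_summable.
Qed.

(* Strong neighborhoods of [x] in a countable amplification, restricted to
   [lambda_span]; this filter is finer than the weak-star neighborhoods. *)
Definition span_filter (x : VN) : set_system VN := fun S =>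
  exists (Fs : seq K) (e : R), 0 < e /\ forall y, lambda_span y ->
    (forall F, F \in Fs -> sqnorm (amp (\val y) F - amp (\val x) F) < e) -> S y.

(** That no member of the filter is empty is precisely [lambda_span_dense]. *)
Lemma span_filter_proper x : ProperFilter (span_filter x).
Proof.
split.
  move=> [Fs [e [e0 h]]]; have [y yD yF] := lambda_span_dense x Fs e0.
  exact: h yD yF.
split.
- by exists [::], 1.
- move=> S T [Fs [e [e0 hS]]] [Gs [d [d0 hT]]].
  exists (Fs ++ Gs), (Num.min e d); split; first by rewrite lt_min e0.
  move=> y yD h; split.
    apply: hS yD _ => F FF; have := h F; rewrite mem_cat FF => /(_ isT).
    by rewrite lt_min => /andP[].
  apply: hT yD _ => F FF; have := h F; rewrite mem_cat FF orbT => /(_ isT).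
  by rewrite lt_min => /andP[].
- move=> S T ST [Fs [e [e0 hS]]]; exists Fs, e; split=> // y yD h.
  by apply: ST; exact: hS.
Qed.

#[local] Existing Instance span_filter_proper.

Lemma span_filter_normal x (p : ell2_sequence R G * ell2_sequence R G) :
  normal_functional p @ span_filter x --> normal_functional p x.
Proof.
apply/cvgrPdist_le => _ /Cplx_gt0[e e0 ->].
set F : K := glue (sval p.1); set g : K := glue (sval p.2).
have k0 : 0 < sqnorm g + 1 by rewrite ltr_wpDl// sqnorm_ge0.
exists [:: F], (e ^+ 2 / (sqnorm g + 1)); split.
  by rewrite divr_gt0// exprn_gt0.
move=> y yD /(_ F (mem_head _ _)); rewrite ltr_pdivlMr// => h.
rewrite /= !normal_functionalE -innerBl modulusE lecR.
rewrite -(ger0_norm (modulus_ge0 _)) -(ger0_norm (ltW e0)).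
rewrite -!sqrtr_sqr ler_sqrt ?sqr_ge0//; apply: le_trans (Cauchy_Schwarz _ _) _.
rewrite sqnorm_subC; apply: ltW; apply: le_lt_trans h.
by rewrite ler_wpM2l ?sqnorm_ge0// lerDl.
Qed.

Lemma span_filter_cvg x : span_filter x --> (x : weak_star R G).
Proof.
apply/cvg_sup => p A; rewrite nbhsE => -[B [[V Vo <-] Vx] VA].
rewrite /=; apply: filterS VA _; apply: (span_filter_normal (p := p)).
exact: open_nbhs_nbhs.
Qed.

Lemma normal_functional_continuous p :
  continuous (normal_functional p : weak_star R G -> C).
Proof.
move=> x; have /cvg_sup/(_ p) h : nbhs (x : weak_star R G) --> (x : weak_star R G).
  exact: cvg_id.
move=> A Ax; apply: h; exact: (@initial_continuous _ _ (normal_functional p) x A Ax).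
Qed.

Lemma point_sequence_subproof (u : H) :
  cvgn (series (fun n => `|if n == 0 then u else 0| ^+ 2) : nat -> C).
Proof.
apply/cvg_ex; exists (`|u| ^+ 2); apply: cvg_near_cst; exists 1%N => // -[//|N] _ /=.
rewrite seriesEnat/= big_nat_recl//= big1 ?addr0// => n _.
by rewrite normr0 expr0n.
Qed.

(** The sequence [u, 0, 0, ...]; gluing it gives [embed 0 u], so each Fourier coefficient is a
    normal functional. *)
Definition point_sequence (u : H) : ell2_sequence R G :=
  exist (fun f : nat -> H => cvgn (series (fun n => `|f n| ^+ 2)))
    (fun n => if n == 0 then u else 0) (@point_sequence_subproof u).

Lemma normal_functional_coef s y :
  normal_functional (point_sequence (delta R 1%g), point_sequence (delta R s)) y =
  fourier_coef y s.
Proof.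
rewrite normal_functionalE.
change (inner (amp (\val y) (embed 0%N (delta R 1%g))) (embed 0%N (delta R s)) =
  fourier_coef y s).
rewrite (amp_embed (vc y)) inner_embed slice_embed.
by rewrite eqxx inner_delta fourier_coefE.
Qed.

(** Both sides are weak-star continuous in [x] and agree on the span of the translations; uniqueness
    of limits along [span_filter x] concludes. *)
Lemma fourier_coef_multiplier (phi : G -> C) (M : {linear VN -> VN}) x s :
  fourier_multiplier phi M -> fourier_coef (M x) s = phi s * fourier_coef x s.
Proof.
move=> [Mc Ml].
pose p := (point_sequence (delta R 1%g), point_sequence (delta R s)).
have lhs : (fun y => fourier_coef (M y) s) @ span_filter x --> fourier_coef (M x) s.
  under eq_cvg do rewrite -normal_functional_coef; rewrite -normal_functional_coef.
  move=> A Ax; have h1 := @normal_functional_continuous p (M x) A Ax.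
  have h2 := Mc x _ h1; exact: (@span_filter_cvg x _ h2).
have rhs :
    (fun y => phi s * fourier_coef y s) @ span_filter x -->
    phi s * fourier_coef x s.
  apply: cvgMl_tmp; under eq_cvg do rewrite -normal_functional_coef.
  rewrite -normal_functional_coef; exact: span_filter_normal.
apply: (@cvg_unique _ (@norm_hausdorff _ _) _ _ _ _ lhs).
apply: cvg_trans rhs; apply: near_eq_cvg.
(* Members of the filter are only tested on [lambda_span], so no closeness to [x] is required. *)
exists [::], 1; split=> // y yD _.
apply: (yD [set y | phi s * fourier_coef y s = fourier_coef (M y) s]) => /=.
- by rewrite linear0 fourier_coefE [X in phi s * X](_ : _ = 0)// mulr0.
- move=> c u v hu hv; rewrite linearP !(fourier_coef_linear s) -hu -hv.
  by rewrite mulrDr; congr (_ + _); exact: mulrCA.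
- move=> t; rewrite Ml.
  rewrite fourier_coefZ.
  by rewrite fourier_coef_lambda; case: eqP => [->//|_]; rewrite !mulr0.
Qed.

End WeakStar.

(** * Positive definite functions and the multiplicative domain *)

Section PositiveDefinite.
Variables (R : realType) (G : groupType).
Local Notation C := (Cplx R).
Variable phi : G -> C.
Hypotheses (phi_pd : positive_definite phi) (phi1 : phi 1%g = 1).

Lemma positive_definite3 (g h : G) (a b c : C) :
  0 <= a^* * a + b^* * b + c^* * c + a^* * b * phi g + b^* * a * phi g^-1%g +
       a^* * c * phi h + c^* * a * phi h^-1%g +
       b^* * c * phi (g^-1 * h)%g + c^* * b * phi (h^-1 * g)%g.
Proof.
have := @phi_pd 3 (nth 1%g [:: 1%g; g; h]) (nth 0 [:: a; b; c]).
rewrite !big_ord_recl !big_ord0 /= !invg1 !mul1g !mulg1 !mulVg phi1 !mulr1 !addr0.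
by congr (0 <= _); ring.
Qed.

(** Nonnegative numbers are real. The weights [1, 1] and [1, 'i] at the points [1, g] show that
    [phi g + phi g^-1] and ['i (phi g - phi g^-1)] are real. *)
Lemma positive_definiteV (g : G) : phi g^-1%g = (phi g)^*.
Proof.
have h1 := CrealP (ger0_real (positive_definite3 g 1%g 1 1 0)).
have hi := CrealP (ger0_real (positive_definite3 g 1%g 1 'i 0)).
move: h1 hi; rewrite !(rmorphD, rmorphM, rmorph1, rmorph0)/= !conjCK !conjCi.
rewrite !(mul0r, mulr0, mul1r, mulr1, addr0, conjC0, conjC1) ?mulNr => h1 hi.
have {}h1 : (phi g)^* + (phi g^-1%g)^* = phi g + phi g^-1%g.
  by apply: (addrI (1 + 1)); rewrite !addrA.
have i2 : 'i * 'i = -1 :> C by rewrite -expr2 sqrCi.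
have {}hi : (phi g^-1%g)^* - (phi g)^* = phi g - phi g^-1%g.
  apply: (mulfI (neq0Ci C)).
  apply: (addrI (1 + - ('i * 'i))); apply: etrans (etrans hi _); ring.
have two0 : 2%:R != 0 :> C by rewrite pnatr_eq0.
apply: (mulfI two0).
transitivity (phi g + phi g^-1%g - (phi g - phi g^-1%g)); first ring.
by rewrite -h1 -hi; ring.
Qed.

(* Positivity at the points 1, g, g * h and the vector [- phi g; 1; - conj D] gives
   [0 <= - |D|^2]. *)
Lemma unimodular_mull (g h : G) : `|phi g| = 1 -> phi (g * h)%g = phi g * phi h.
Proof.
move=> g1; have gg : phi g * (phi g)^* = 1 by rewrite -normCK g1 expr1n.
pose D := phi h - (phi g)^* * phi (g * h)%g.
have := positive_definite3 g (g * h)%g (- phi g) 1 (- D^*).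
rewrite !invgM !mulKg -!mulgA mulVg mulg1 -invgM !positive_definiteV.
rewrite !(rmorphN, rmorphM, rmorph1)/= !conjCK.
have DC : D^* = (phi h)^* - phi g * (phi (g * h)%g)^*.
  by rewrite rmorphB rmorphM/= conjCK.
rewrite [X in 0 <= X](_ : _ = (1 - phi g * (phi g)^*) - D * D^*); last first.
  by rewrite DC /D; ring.
rewrite gg subrr sub0r oppr_ge0 -normCK => D0.
have /eqP : D = 0.
  by apply/eqP; rewrite -normr_eq0 -sqrf_eq0 eq_le D0 exprn_ge0.
by rewrite subr_eq0 => /eqP ->; rewrite mulrA gg mul1r.
Qed.

(** Inversion exchanges the two factors, and [phi] turns it into conjugation, so the left version
    applies. *)
Lemma unimodular_mulr (g h : G) : `|phi g| = 1 -> phi (h * g)%g = phi h * phi g.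
Proof.
move=> g1; have gV : `|phi g^-1%g| = 1 by rewrite positive_definiteV norm_conjC.
rewrite -[(h * g)%g]invgK invgM positive_definiteV (unimodular_mull _ gV).
by rewrite rmorphM/= !positive_definiteV !conjCK mulrC.
Qed.

End PositiveDefinite.

Theorem proposition10p4 (R : realType) (G : groupType) (phi : G -> Cplx R)
    (Mphi : {linear group_vn R G -> group_vn R G}) :
  positive_definite phi -> phi 1%g = 1 -> fourier_multiplier phi Mphi ->
  (forall x : group_vn R G,
     multiplicative_domain Mphi x <->
     (forall s : G, fourier_coef x s != 0 -> `|phi s| = 1)) /\
  multiplicative_domain Mphi = vn_subalgebra (unimodular_set phi).
Proof.
move=> phi_pd phi1 phiM.
have coefM x s := fourier_coef_multiplier x s phiM.
have MDP x : multiplicative_domain Mphi x <->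
    (forall s : G, fourier_coef x s != 0 -> `|phi s| = 1).
  split=> [xMD s xs0|xK y].
    have [h _] := xMD (vn_lambda R s^-1%g).
    have coef1 z : fourier_coef (z * vn_lambda R s^-1%g) 1%g = fourier_coef z s.
      by rewrite [LHS]/fourier_coef invg1 vn_lambda1 mulr1.
    have := congr1 (fun z => fourier_coef z 1%g) h.
    rewrite coefM phi1 mul1r phiM.2 -scalerAr fourier_coefZ !coef1 coefM.
    rewrite positive_definiteV// mulrA [_^* * _]mulrC -normCK => /esym/eqP.
    rewrite -subr_eq0 -{2}[fourier_coef x s]mul1r -mulrBl mulf_eq0 (negPf xs0) orbF.
    rewrite subr_eq0 => /eqP h2; apply/eqP.
    by rewrite -(@pexpr_eq1 _ _ 2)// h2.
  (* Both sides are convolution sums, compared term by term: either the coefficient of [x] vanishes,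
     or [phi] is multiplicative on [s = (s * r^-1) * r], whose unimodular factor is the index of
     [x]. *)
  split; apply: fourier_coef_inj => s; rewrite coefM -fourier_coefZ.
    rewrite scalerAl !fourier_coefM; congr summability.sum.
    apply/funext => r; rewrite fourier_coefZ !coefM.
    have [->|xr0] := eqVneq (fourier_coef x (s * r^-1)%g) 0; first by rewrite !mulr0.
    rewrite -[in phi s](mulgVK r s) (unimodular_mull phi_pd phi1 _ (xK _ xr0)).
    by ring.
  rewrite scalerAl !fourier_coefM; congr summability.sum.
  apply/funext => r; rewrite fourier_coefZ !coefM.
  have [->|xr0] := eqVneq (fourier_coef x r) 0; first by rewrite !(mulr0, mul0r).
  rewrite -[in phi s](mulgVK r s) (unimodular_mulr phi_pd phi1 _ (xK _ xr0)).
  by ring.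
split=> //; apply/seteqP.
suff xP x : multiplicative_domain Mphi x <-> vn_subalgebra (unimodular_set phi) x.
  by split=> x /xP.
rewrite MDP vn_subalgebraP//; last by rewrite /unimodular_set/= phi1 normr1.
(* Invariance of the unimodular set: [k^-1] is unimodular too, hence [phi (k^-1 * s)] and [phi s]
   have equal modulus. *)
move=> k s Kk; have kV : `|phi k^-1%g| = 1 by rewrite positive_definiteV// norm_conjC.
have kE : `|phi (k^-1 * s)%g| = `|phi s|.
  by rewrite (unimodular_mull phi_pd phi1 _ kV) normrM kV mul1r.
by apply/idP/idP => /set_mem sK; apply/mem_set; move: sK; rewrite /unimodular_set /= kE.
Qed.
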